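(* Let $F$ and $T$ be Richard Thompson's groups, let $\lambda$ be the left regular representation of $T$ (extended linearly to the group algebra $\mathbb{C}[T]$), let $C^*_\lambda(T)$ be the reduced $C^*$-algebra of $T$, and let $\pi$ be the permutation representation of $T$ on $\ell^2$ of the dyadic rational points of the circle. Then $F$ is non-amenable if and only if there exists a finite set $H\subset T$ which can be decomposed as a disjoint union $H=H_1\sqcup H_2$ with $$\sum_{g\in H_1}\pi(g)=\sum_{h\in H_2}\pi(h)$$ and such that the closed two-sided ideal of $C^*_\lambda(T)$ generated by $$\sum_{g\in H_1}\lambda(g)-\sum_{h\in H_2}\lambda(h)$$ coincides with $C^*_\lambda(T)$.
   Context: $S^1=\mathbb{R}/\mathbb{Z}$. Thompson's group $T$ is the group of orientation-preserving piecewise-linear homeomorphisms of $S^1$ that map the set $\mathbb{Z}[\frac12]/\mathbb{Z}$ of dyadic rational points to itself, are differentiable except at finitely many dyadic rational points, and whose slopes (where defined) are integer powers of $2$. Thompson's group $F$ is the stabiliser of the point $0$ in $T$. The reduced $C^*$-algebra $C^*_\lambda(T)$ is the norm closure of $\lambda(\mathbb{C}[T])$ in $B(\ell^2(T))$, where $\lambda(g)\delta_t=\delta_{gt}$. The representation $\pi:T\to B(\ell^2(\mathbb{Z}[\frac12]/\mathbb{Z}))$ is the one induced by the action of $T$ on dyadic rational points: $\pi(g)\delta_x=\delta_{g\cdot x}$. *)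

(* Defs.v *)
From HB Require Import structures.
From mathcomp Require Import all_boot all_order all_algebra.
From mathcomp Require Import finmap.
From mathcomp Require Import boolp classical_sets functions cardinality fsbigop.
From mathcomp Require Import reals constructive_ereal ereal topology normedtype.
From mathcomp Require Import esum realfun.
From mathcomp Require Import ring lra.
From mathcomp Require Import generic_quotient ring_quotient complex.

Set Implicit Arguments.
Unset Strict Implicit.
Unset Printing Implicit Defensive.

Import Order.TTheory GRing.Theory Num.Theory.
Import numFieldNormedType.Exports.

Local Open Scope classical_set_scope.
Local Open Scope ring_scope.
Local Open Scope quotient_scope.
Local Open Scope complex_scope.

Section L2.
Variables (R : realType) (X : choiceType).

(* Normc.normc is the R-valued modulus on R[i]. *)
Definition l2_sqnorm (u : X -> R[i]) : \bar R :=
  \esum_(x in [set: X]) ((Normc.normc (u x)) ^+ 2)%:E.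

Definition square_summable (u : X -> R[i]) : Prop := (l2_sqnorm u < +oo)%E.

Lemma l2_sqnorm_ge0 u : (0 <= l2_sqnorm u)%E.
Proof. by apply: esum_ge0 => x _; rewrite lee_fin sqr_ge0. Qed.

Lemma l2_sqnormZ a u :
  (l2_sqnorm (a *: u)%R <= (Normc.normc a ^+ 2)%:E * l2_sqnorm u)%E.
Proof.
apply: ub_ereal_sup => _ [A [finA _] <-].
rewrite [leLHS](_ : _ = (Normc.normc a ^+ 2)%:E *
    \sum_(x \in A) ((Normc.normc (u x)) ^+ 2)%:E)%E; last first.
  rewrite !fsbig_finite//= !sumEFin -EFinM mulr_sumr; congr EFin.
  by apply: eq_bigr => x _; rewrite /= Normc.normcM exprMn.
apply: lee_wpmul2l; first by rewrite lee_fin sqr_ge0.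
by apply: ereal_sup_ubound; exists A.
Qed.

Lemma l2_sqnormD (s t : R) u v : 0 < s -> 0 < t ->
  (l2_sqnorm (u + v)%R
    <= ((s + t) / s)%:E * l2_sqnorm u + ((s + t) / t)%:E * l2_sqnorm v)%E.
Proof.
move=> s0 t0; apply: ub_ereal_sup => _ [A [finA _] <-].
pose S (w : X -> R[i]) := (\sum_(x \in A) ((Normc.normc (w x)) ^+ 2)%:E)%E.
have SQ w : (S w <= l2_sqnorm w)%E by apply: ereal_sup_ubound; exists A.
apply: (@le_trans _ _ (((s + t) / s)%:E * S u + ((s + t) / t)%:E * S v)%E).
  rewrite /S !fsbig_finite//= !sumEFin -!EFinM -EFinD lee_fin !mulr_sumr.
  rewrite -big_split/=; apply: ler_sum => x _.
  set a := Normc.normc (u x); set b := Normc.normc (v x).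
  have a0 : 0 <= a by rewrite -ler0c -[a%:C]/(`|u x|).
  have b0 : 0 <= b by rewrite -ler0c -[b%:C]/(`|v x|).
  apply: (@le_trans _ _ ((a + b) ^+ 2)).
    rewrite ler_pXn2r ?nnegrE ?addr_ge0 ?le_normcD//.
    by rewrite -ler0c -[_%:C]/(`|(u + v) x|).
  rewrite -subr_ge0.
  rewrite (_ : _ - _ = (t * a - s * b) ^+ 2 / (s * t)); last first.
    by field; rewrite !gt_eqF.
  by rewrite divr_ge0 ?sqr_ge0// mulr_ge0// ltW.
by apply: leeD; apply: lee_wpmul2l => //; rewrite lee_fin divr_ge0// ltW//
  addr_gt0.
Qed.

Lemma square_summable_submod_closed :
  submod_closed [pred u : X -> R[i] | `[< square_summable u >]].
Proof.
split=> [|a u v]; rewrite !inE.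
  rewrite /square_summable /l2_sqnorm esum1// => x _.
  by rewrite Normc.normc0 expr0n.
move=> hu hv.
have fin w : square_summable w -> l2_sqnorm w \is a fin_num.
  by move=> hw; rewrite ge0_fin_numE ?l2_sqnorm_ge0.
have hau : square_summable (a *: u).
  apply: (le_lt_trans (l2_sqnormZ _ _)).
  by rewrite -(fineK (fin _ hu)) -EFinM ltry.
apply: (le_lt_trans (l2_sqnormD _ _ ltr01 ltr01)).
by rewrite -(fineK (fin _ hau)) -(fineK (fin _ hv)) -!EFinM -EFinD ltry.
Qed.

Definition l2 : Type := {u : X -> R[i] | `[< square_summable u >]}.
HB.instance Definition _ := [isSub of l2 for @sval _ _].
HB.instance Definition _ := [Choice of l2 by <:].
HB.instance Definition _ := GRing.SubChoice_isSubLmodule.Build _ _ _ l2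
  square_summable_submod_closed.

Definition l2_norm (u : l2) : R := Num.sqrt (fine (l2_sqnorm (val u))).

Lemma l2_norm_ge0 u : 0 <= l2_norm u. Proof. exact: sqrtr_ge0. Qed.

Lemma l2_sqnormE (u : l2) : l2_sqnorm (val u) = (l2_norm u ^+ 2)%:E.
Proof.
have hu : square_summable (val u) by apply/asboolP; exact: (valP u).
rewrite sqr_sqrtr ?fine_ge0 ?l2_sqnorm_ge0// fineK//.
by rewrite ge0_fin_numE ?l2_sqnorm_ge0.
Qed.

Lemma l2_norm_le (u : l2) (M : R) :
  0 <= M -> (l2_sqnorm (val u) <= (M ^+ 2)%:E)%E -> l2_norm u <= M.
Proof.
by move=> M0; rewrite l2_sqnormE lee_fin ler_pXn2r// nnegrE l2_norm_ge0.
Qed.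

Lemma l2_norm0_eq0 (u : l2) : l2_norm u = 0 -> u = 0.
Proof.
move=> u0; apply: val_inj; apply/funext => x; rewrite raddf0/=.
apply: Normc.eq0_normc.
have: ((Normc.normc (val u x) ^+ 2)%:E <= l2_sqnorm (val u))%E.
  apply: esum_ge; exists [set x]; last by rewrite fsbig_set1.
  by split=> //; exact: finite_set1.
rewrite l2_sqnormE u0 expr0n lee_fin/= => h; apply/eqP.
by rewrite -sqrf_eq0 eq_le h sqr_ge0.
Qed.

Lemma l2_normZ_le a (u : l2) : l2_norm (a *: u) <= Normc.normc a * l2_norm u.
Proof.
have a0 : 0 <= Normc.normc a by rewrite -ler0c -[_%:C]/(`|a|).
apply: l2_norm_le; first by rewrite mulr_ge0// l2_norm_ge0.
by rewrite linearZ/= (le_trans (l2_sqnormZ _ _))// l2_sqnormE -EFinM exprMn.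
Qed.

Lemma l2_normZ a (u : l2) : l2_norm (a *: u) = Normc.normc a * l2_norm u.
Proof.
apply/eqP; rewrite eq_le l2_normZ_le/=.
have [->|a0] := eqVneq a 0; first by rewrite Normc.normc0 mul0r l2_norm_ge0.
rewrite -[in leLHS](scalerK a0 u).
have na0 : Normc.normc a != 0 by apply: contra_neq a0 => /Normc.eq0_normc.
have a_gt0 : 0 < Normc.normc a by rewrite lt0r na0 -ler0c -[_%:C]/(`|a|) /=.
rewrite -ler_pdivlMl//; apply: (le_trans (l2_normZ_le _ _)).
by rewrite Normc.normcV.
Qed.

Lemma l2_normD (u v : l2) : l2_norm (u + v) <= l2_norm u + l2_norm v.
Proof.
have [/l2_norm0_eq0->|u0] := eqVneq (l2_norm u) 0.
  by rewrite add0r lerDr l2_norm_ge0.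
have [/l2_norm0_eq0->|v0] := eqVneq (l2_norm v) 0.
  by rewrite addr0 lerDl l2_norm_ge0.
have u_gt0 : 0 < l2_norm u by rewrite lt0r u0 l2_norm_ge0.
have v_gt0 : 0 < l2_norm v by rewrite lt0r v0 l2_norm_ge0.
apply: l2_norm_le; first by rewrite addr_ge0// ltW.
rewrite raddfD/=; apply: (le_trans (l2_sqnormD _ _ u_gt0 v_gt0)).
rewrite !l2_sqnormE -!EFinM -EFinD lee_fin.
by rewrite le_eqVlt; apply/orP; left; apply/eqP; field; rewrite u0 v0.
Qed.

Lemma l2_normC_D (u v : l2) :
  (l2_norm (u + v))%:C <= (l2_norm u)%:C + (l2_norm v)%:C :> R[i].
Proof. by rewrite -rmorphD lecR l2_normD. Qed.

Lemma l2_normC_Z (a : R[i]) (u : l2) :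
  (l2_norm (a *: u))%:C = `|a| * (l2_norm u)%:C :> R[i].
Proof. by rewrite l2_normZ rmorphM. Qed.

Lemma l2_normC_eq0 (u : l2) : (l2_norm u)%:C = 0 :> R[i] -> u = 0.
Proof. by move=> /complexI/l2_norm0_eq0. Qed.

(* Norms on a normedModType over R[i] are R[i]-valued, whence the embedding
   %:C of the real norm. *)
HB.instance Definition _ :=
  Lmodule_isNormed.Build R[i] l2 l2_normC_D l2_normC_Z l2_normC_eq0.

End L2.

Section BoundedOperators.
Variables (R : realType) (V : normedModType R[i]).
Implicit Types f g : V -> V.

Definition op_bound f (M : R) : Prop :=
  0 <= M /\ forall x, `|f x| <= M%:C * `|x|.

Definition bounded_op f : Prop := linear f /\ exists M, op_bound f M.

Lemma bounded_op_submod_closed :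
  submod_closed [pred f : V -> V | `[< bounded_op f >]].
Proof.
split=> [|a f g]; rewrite !inE.
  split=> [b x y|]; first by rewrite -[RHS]/(b *: 0 + 0) scaler0 addr0.
  by exists 0; split=> // x; rewrite normr0 mul0r.
move=> [lf [M [M0 hM]]] [lg [N [N0 hN]]]; split=> [b x y|].
  rewrite !fctE lf lg !scalerDr !scalerA (mulrC a b) -!addrA; congr (_ + _).
  by rewrite addrCA.
have na : `|a| = (Normc.normc a)%:C by [].
have a0 : 0 <= Normc.normc a by rewrite -ler0c -na.
exists (Normc.normc a * M + N); split=> [|x]; first by rewrite addr_ge0// mulr_ge0.
rewrite !fctE (le_trans (ler_normD _ _))// rmorphD mulrDl lerD// normrZ.
by rewrite rmorphM -mulrA na ler_wpM2l// -na.
Qed.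

(* B(V): the bounded linear endomorphisms of V. It is made into a ring under
   composition and a normed R[i]-module under the operator norm, so that closure
   and closed below refer to the norm topology. *)
Definition bop : Type := {f : V -> V | `[< bounded_op f >]}.
HB.instance Definition _ := [isSub of bop for @sval _ _].
HB.instance Definition _ := [Choice of bop by <:].
HB.instance Definition _ := GRing.SubChoice_isSubLmodule.Build _ _ _ bop
  bounded_op_submod_closed.

Definition mk_bop f (hf : bounded_op f) : bop := Sub f (asboolT hf).

Lemma bopP (a : bop) : bounded_op (val a).
Proof. by apply/asboolP; exact: (valP a). Qed.

Lemma bounded_op_id : bounded_op id.
Proof. by split=> //; exists 1; split=> // x; rewrite mul1r. Qed.

Lemma bounded_op_comp f g : bounded_op f -> bounded_op g -> bounded_op (f \o g).
Proof.
move=> [lf [M [M0 hM]]] [lg [N [N0 hN]]]; split=> [b x y|].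
  by rewrite /= lg lf.
exists (M * N); split=> [|x /=]; first exact: mulr_ge0.
by rewrite (le_trans (hM _))// rmorphM -mulrA ler_wpM2l// ler0c.
Qed.

Definition bop1 : bop := mk_bop bounded_op_id.
Definition bop_mul (a b : bop) : bop :=
  mk_bop (bounded_op_comp (bopP a) (bopP b)).

Lemma bop_eq (a b : bop) : (forall x, val a x = val b x) -> a = b.
Proof. by move=> ab; apply: val_inj; apply/funext. Qed.

Lemma bop_addE (a b : bop) x : val (a + b) x = val a x + val b x.
Proof. by rewrite raddfD. Qed.

Lemma bop_scaleE c (a : bop) x : val (c *: a) x = c *: val a x.
Proof. by rewrite linearZ. Qed.

Lemma bop_mulA : associative bop_mul. Proof. by move=> a b c; exact: bop_eq. Qed.
Lemma bop_mul1l : left_id bop1 bop_mul. Proof. by move=> a; exact: bop_eq. Qed.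
Lemma bop_mul1r : right_id bop1 bop_mul. Proof. by move=> a; exact: bop_eq. Qed.
Lemma bop_mulDl : left_distributive bop_mul +%R.
Proof. by move=> a b c; apply: bop_eq => x; rewrite bop_addE. Qed.
Lemma bop_mulDr : right_distributive bop_mul +%R.
Proof.
move=> a b c; apply: bop_eq => x; rewrite bop_addE /=.
rewrite -[LHS]/(val a (val b x + val c x)).
by have [la _] := bopP a; have := la 1 (val b x) (val c x); rewrite !scale1r.
Qed.
HB.instance Definition _ := GRing.Zmodule_isPzRing.Build bop
  bop_mulA bop_mul1l bop_mul1r bop_mulDl bop_mulDr.

(* The least operator bound, i.e. the supremum of `|a x| / `|x|. *)
Definition op_norm (a : bop) : R := inf [set M | op_bound (val a) M].

Lemma op_bound_nonempty (a : bop) : [set M | op_bound (val a) M] !=set0.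
Proof. by have [_ [M hM]] := bopP a; exists M. Qed.

Lemma op_norm_le (a : bop) M : op_bound (val a) M -> op_norm a <= M.
Proof. by move=> hM; apply: ge_inf => //; exists 0 => N []. Qed.

Lemma op_norm_ge0 (a : bop) : 0 <= op_norm a.
Proof. by apply: lb_le_inf; [exact: op_bound_nonempty|move=> M []]. Qed.

Lemma op_normP (a : bop) : op_bound (val a) (op_norm a).
Proof.
split=> [|x]; first exact: op_norm_ge0.
have normE (y : V) : `|y| = (complex.Re `|y|)%:C by rewrite RRe_real ?normr_real.
have N0 (y : V) : 0 <= complex.Re `|y| by rewrite -ler0c -normE.
have [->|x0] := eqVneq x 0.
  have [la _] := bopP a; have := la (-1) 0 0.
  by rewrite scaler0 addr0 scaleN1r addNr => ->; rewrite !normr0 mulr0.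
have Nx : 0 < complex.Re `|x| by rewrite -ltcR -normE normr_gt0.
rewrite normE [in leRHS]normE -rmorphM lecR -ler_pdivrMr//.
apply: lb_le_inf; first exact: op_bound_nonempty.
move=> M [M0 hM]; rewrite ler_pdivrMr//.
by have := hM x; rewrite normE [in leRHS]normE -rmorphM lecR.
Qed.

Lemma op_normD (a b : bop) :
  (op_norm (a + b))%:C <= (op_norm a)%:C + (op_norm b)%:C :> R[i].
Proof.
have [a0 ha] := op_normP a; have [b0 hb] := op_normP b.
rewrite -rmorphD lecR; apply: op_norm_le; split=> [|x]; first exact: addr_ge0.
by rewrite bop_addE (le_trans (ler_normD _ _))// rmorphD mulrDl lerD.
Qed.

Lemma op_normZ_le (c : R[i]) (a : bop) :
  op_norm (c *: a) <= Normc.normc c * op_norm a.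
Proof.
have [a0 ha] := op_normP a.
have c0 : 0 <= Normc.normc c by rewrite -ler0c -[_%:C]/(`|c|).
apply: op_norm_le; split=> [|x]; first exact: mulr_ge0.
have -> : (Normc.normc c * op_norm a)%:C = `|c| * (op_norm a)%:C :> R[i].
  by rewrite rmorphM.
by rewrite bop_scaleE normrZ -mulrA; exact: ler_wpM2l.
Qed.

Lemma op_normZ (c : R[i]) (a : bop) :
  (op_norm (c *: a))%:C = `|c| * (op_norm a)%:C :> R[i].
Proof.
have <- : (Normc.normc c * op_norm a)%:C = `|c| * (op_norm a)%:C :> R[i].
  by rewrite rmorphM.
congr (_%:C); apply/eqP.
rewrite eq_le op_normZ_le/=.
have [->|c0] := eqVneq c 0; first by rewrite Normc.normc0 mul0r op_norm_ge0.
have nc0 : Normc.normc c != 0 by apply: contra_neq c0 => /Normc.eq0_normc.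
have c_gt0 : 0 < Normc.normc c by rewrite lt0r nc0 -ler0c -[_%:C]/(`|c|) /=.
rewrite -ler_pdivlMl// -Normc.normcV -[in leLHS](scalerK c0 a).
exact: op_normZ_le.
Qed.

Lemma op_norm_eq0 (a : bop) : (op_norm a)%:C = 0 :> R[i] -> a = 0.
Proof.
move=> /complexI a0; apply: bop_eq => x; rewrite raddf0/=; apply/eqP.
have [_ /(_ x)] := op_normP a.
by rewrite a0 mul0r normr_le0.
Qed.

HB.instance Definition _ :=
  Lmodule_isNormed.Build R[i] bop op_normD op_normZ op_norm_eq0.

End BoundedOperators.

Section CompositionOperators.
Variables (R : realType) (X : choiceType).

Lemma l2_sqnorm_comp (h : X -> X) (u : X -> R[i]) :
  injective h -> (l2_sqnorm (u \o h) <= l2_sqnorm u)%E.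
Proof.
move=> hi; rewrite /l2_sqnorm.
rewrite -(@esum_image _ _ _ setT h (fun y => ((Normc.normc (u y)) ^+ 2)%:E));
  last first.
  by move=> x y _ _; exact: hi.
apply: le_ereal_sup => _ [A [finA _] <-]; exists A => //; split=> //.
Qed.

Lemma square_summable_comp (h : X -> X) (hi : injective h) (u : l2 R X) :
  `[< square_summable (val u \o h) >].
Proof.
apply: asboolT; apply: (le_lt_trans (l2_sqnorm_comp _ hi)).
by apply/asboolP; exact: (valP u).
Qed.

Definition l2_comp (h : X -> X) (hi : injective h) (u : l2 R X) : l2 R X :=
  Sub (val u \o h) (square_summable_comp hi u).

Lemma l2_comp_bounded (h : X -> X) (hi : injective h) :
  bounded_op (l2_comp hi).
Proof.
split=> [a u v|].
  by apply: val_inj; apply/funext => x.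
exists 1; split=> // u; rewrite mul1r.
rewrite -[leRHS]/((l2_norm u)%:C) -[leLHS]/((l2_norm (l2_comp hi u))%:C) lecR.
apply: l2_norm_le; first exact: l2_norm_ge0.
by rewrite -l2_sqnormE; exact: l2_sqnorm_comp.
Qed.

(* The operator u |-> u \o h; it maps the basis vector at x to the one at
   h^-1 x (comp_op_delta). *)
Definition comp_op (h : X -> X) (hi : injective h) : bop (l2 R X) :=
  mk_bop (l2_comp_bounded hi).

Lemma square_summable_delta (x : X) :
  `[< square_summable (fun y : X => (y == x)%:R : R[i]) >].
Proof.
apply: asboolT; rewrite /square_summable /l2_sqnorm.
rewrite (esumID [set x])//; last by move=> y _; rewrite lee_fin sqr_ge0.
rewrite setTI esum_set1 ?lee_fin ?sqr_ge0// [X in (_ + X)%E]esum1 ?adde0 ?ltry//.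
by move=> y [_ /eqP/negbTE->]; rewrite Normc.normc0 expr0n.
Qed.

Definition l2_delta (x : X) : l2 R X :=
  Sub (fun y : X => (y == x)%:R) (square_summable_delta x).

Lemma comp_op_delta (h k : X -> X) (hi : injective h) (x : X) :
  cancel h k -> cancel k h -> val (comp_op hi) (l2_delta x) = l2_delta (k x).
Proof.
move=> hK kK; apply: val_inj; apply/funext => y /=; congr (_%:R).
by rewrite -[in RHS](hK y) (can_eq kK).
Qed.

End CompositionOperators.

(* G carries a finitely additive left-invariant probability measure defined on
   all subsets. *)
Definition amenable (R : realType) (G : groupType) : Prop :=
  exists mu : set G -> R,
    [/\ mu [set: G] = 1,
        forall A, 0 <= mu A,
        forall A B, A `&` B = set0 -> mu (A `|` B) = mu A + mu B &
        forall g A, mu ((fun x => (g * x)%g) @` A) = mu A].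

Section Circle.
Variable R : realType.

Definition integers : {pred R} := fun x => x \is a Num.int.

Lemma integers_zmod_closed : zmod_closed integers.
Proof. by split=> [|x y]; [exact: rpred0|exact: rpredB]. Qed.
HB.instance Definition _ := GRing.isZmodClosed.Build R integers
  integers_zmod_closed.

Definition circle : Type := quotient_topology {ideal_quot integers}.
HB.instance Definition _ := Topological.on circle.
HB.instance Definition _ := Choice.on circle.
HB.instance Definition _ := Quotient.on circle.

Definition circle_pt (x : R) : circle := \pi_circle x.

Lemma circle_ptP (x y : R) :
  circle_pt x = circle_pt y <-> exists m : int, x = y + m%:~R.
Proof.
have E : (circle_pt x = circle_pt y) <-> (x - y \is a Num.int).
  rewrite -[x - y \is a Num.int]/(x - y \in integers) Quotient.idealrBE.
  by split=> [xy|/eqP xy]; [apply/eqP; exact: xy|exact: xy].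
rewrite E; split=> [/intrP[m xym]|[m ->]].
  by exists m; rewrite -xym addrC subrK.
by rewrite addrAC subrr add0r intr_int.
Qed.

Lemma circle_pt_surj (p : circle) : exists x, circle_pt x = p.
Proof. by exists (repr p); rewrite /circle_pt reprK. Qed.

Definition dyadic : set circle :=
  [set circle_pt (m%:~R / 2 ^+ n) | m in [set: int] & n in [set: nat]].
End Circle.
Arguments dyadic R : clear implicits.

Section ThompsonT.
Variable R : realType.
Implicit Types (f g : circle R -> circle R) (F G : R -> R).

Definition homeomorphism f : Prop :=
  exists g, [/\ cancel f g, cancel g f, continuous f & continuous g].

(* Orientation-preserving: the circle map f lifts to an increasing continuous
   map F of the real line commuting with the translation by 1. *)
Definition oriented_lift f F : Prop :=
  [/\ continuous F, {homo F : x y / x < y}, (forall x, F (x + 1) = F x + 1) &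
      forall x, circle_pt (F x) = f (circle_pt x)].

(* s lists the breakpoints: F is affine, with slope a power of 2, on every
   segment whose interior contains no point lying over s. *)
Definition dyadic_pl F : Prop :=
  exists s : seq (circle R),
    (forall p, p \in s -> dyadic R p) /\
    forall a b, a < b -> (forall x, a < x < b -> circle_pt x \notin s) ->
      exists (k : int) (c : R), forall x, a <= x <= b -> F x = 2 ^ k * x + c.

Definition in_thompsonT f : Prop :=
  [/\ homeomorphism f, f @` dyadic R = dyadic R &
      exists F, oriented_lift f F /\ dyadic_pl F].

Lemma oriented_lift_int f F (m : int) x :
  oriented_lift f F -> F (x + m%:~R) = F x + m%:~R.
Proof.
move=> [_ _ F1 _].
have Fn (n : nat) y : F (y + n%:R) = F y + n%:R.
  elim: n y => [|n IH] y; first by rewrite !addr0.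
  by rewrite -natr1 !addrA F1 IH.
case: m => [n|n]; first exact: Fn.
rewrite NegzE !intrN -[in RHS](subrK (n.+1%:R) x) Fn.
by rewrite -[n.+1%:~R]/(n.+1%:R) addrK.
Qed.

Lemma oriented_lift_inv f g F : cancel f g -> cancel g f ->
  oriented_lift f F ->
  exists G, [/\ cancel F G, cancel G F & oriented_lift g G].
Proof.
move=> fK gK lF; have [Fc Flt F1 FE] := lF.
have Finj : injective F.
  move=> x y; case: (ltgtP x y) => // /Flt; by [move=> + E; rewrite E ltxx].
have Fsurj y : exists x, F x = y.
  have [x xE] := circle_pt_surj (g (circle_pt y)).
  have /esym/circle_ptP[m ->] : circle_pt (F x) = circle_pt y.
    by rewrite FE xE gK.
  by exists (x + m%:~R); rewrite (oriented_lift_int _ _ lF).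
have [G GK] := choice Fsurj.
have FK : cancel F G by move=> x; apply: Finj; rewrite GK.
exists G; split=> //; split.
- move=> y; rewrite -(GK y).
  apply: nbhs_singleton (near_can_continuous _ _); near=> x; first exact: FK.
  exact: Fc.
- move=> x y xy; rewrite ltNge; apply/negP; rewrite le_eqVlt => /orP[/eqP E|].
    by move: xy; rewrite -(GK x) -(GK y) E ltxx.
  by move=> /Flt; rewrite !GK => /lt_trans/(_ xy); rewrite ltxx.
- by move=> x; apply: Finj; rewrite F1 !GK.
- by move=> x; apply: (can_inj fK); rewrite gK -FE GK.
Unshelve. all: by end_near. Qed.

Lemma in_thompsonT_id : in_thompsonT id.
Proof.
split; first by exists id; split=> // x; exact: cvg_id.
  by rewrite image_id.
exists id; split; first by split=> // x; exact: cvg_id.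
exists [::]; split=> // a b _ _; exists 0, 0 => x _.
by rewrite expr0z mul1r addr0.
Qed.

Lemma in_thompsonT_inv f g : cancel f g -> cancel g f ->
  in_thompsonT f -> in_thompsonT g.
Proof.
move=> fK gK [[g' [fK' gK' fc gc]] fD [F [lF [s [sD sF]]]]].
have gg' : g = g' by apply/funext => x; rewrite -[in LHS](gK' x) fK.
have gD : g @` dyadic R = dyadic R.
  by rewrite -{1}fD image_comp (_ : g \o f = id) ?image_id//; exact/funext.
split=> //; first by exists f; split=> //; rewrite gg'.
have [G [FK GK lG]] := oriented_lift_inv fK gK lF.
have [_ Flt _ FE] := lF; have [_ Glt _ GE] := lG.
have Gle x y : x <= y -> G x <= G y.
  by rewrite !le_eqVlt => /orP[/eqP->|/Glt->]; rewrite ?eqxx ?orbT.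
exists G; split=> //; exists (map f s); split.
  by move=> p /mapP[q qs ->]; rewrite -fD; exists q => //; exact: sD.
move=> a b ab abs.
have [k [c kc]] : exists (k : int) (c : R),
    forall x, G a <= x <= G b -> F x = 2 ^ k * x + c.
  apply: sF => [|x /andP[ax xb]]; first exact: Glt.
  have : circle_pt (F x) \notin map f s.
    by apply: abs; rewrite -(GK a) -(GK b); apply/andP; split; exact: Flt.
  by rewrite FE mem_map//; exact: (can_inj fK).
exists (- k), (- (2 ^ (- k) * c)) => x /andP[ax xb].
have := kc (G x); rewrite !Gle// GK => /(_ isT) xE; rewrite [in RHS]xE.
by rewrite mulrDr mulrA -expfzDr ?pnatr_eq0// addNr expr0z mul1r addrK.
Qed.

Lemma in_thompsonT_comp f g :
  in_thompsonT f -> in_thompsonT g -> in_thompsonT (f \o g).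
Proof.
move=> [[f' [fK f'K fc f'c]] fD [F [lF [s [sD sF]]]]].
move=> [[g' [gK g'K gc g'c]] gD [G [lG [t [tD tG]]]]].
have [Fc Flt F1 FE] := lF; have [Gc Glt G1 GE] := lG.
have Gle x y : x <= y -> G x <= G y.
  by rewrite !le_eqVlt => /orP[/eqP->|/Glt->]; rewrite ?eqxx ?orbT.
split.
- exists (g' \o f'); split; [exact: can_comp|exact: can_comp| |].
    by move=> x; apply: continuous_comp; [exact: gc|exact: fc].
  by move=> x; apply: continuous_comp; [exact: f'c|exact: g'c].
- by rewrite -image_comp gD.
exists (F \o G); split.
  split=> [x|x y /Glt/Flt//|x|x].
  - by apply: continuous_comp; [exact: Gc|exact: Fc].
  - by rewrite /= G1 F1.
  - by rewrite /= FE GE.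
exists (t ++ map g' s); split.
  move=> p; rewrite mem_cat => /orP[/tD//|/mapP[q /sD + ->]].
  by rewrite -{1}gD => -[r rD <-]; rewrite gK.
move=> a b ab abs.
have [k [c kc]] : exists (k : int) (c : R),
    forall x, a <= x <= b -> G x = 2 ^ k * x + c.
  by apply: tG => // x /abs; rewrite mem_cat negb_or => /andP[].
have [G' [GK G'K [_ G'lt _ G'E]]] := oriented_lift_inv gK g'K lG.
have [l [d ld]] : exists (k : int) (c : R),
    forall x, G a <= x <= G b -> F x = 2 ^ k * x + c.
  apply: sF => [|x /andP[ax xb]]; first exact: Glt.
  have : circle_pt (G' x) \notin t ++ map g' s.
    by apply: abs; rewrite -(GK a) -(GK b); apply/andP; split; exact: G'lt.
  by rewrite mem_cat negb_or G'E mem_map => [/andP[]//|]; exact: can_inj g'K.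
exists (l + k), (2 ^ l * c + d) => x /andP[ax xb] /=.
rewrite ld ?Gle// kc ?ax// expfzDr ?pnatr_eq0//; ring.
Qed.

Definition thompsonT : Type :=
  {f : circle R -> circle R | `[< in_thompsonT f >]}.
HB.instance Definition _ := [isSub of thompsonT for @sval _ _].
HB.instance Definition _ := [Choice of thompsonT by <:].

Lemma thompsonTP (g : thompsonT) : in_thompsonT (val g).
Proof. by apply/asboolP; exact: (valP g). Qed.

Lemma thompsonT_inv_ex (g : thompsonT) :
  exists h : thompsonT, cancel (val g) (val h) /\ cancel (val h) (val g).
Proof.
have [[h [gK hK _ _]] _ _] := thompsonTP g.
have hT := in_thompsonT_inv gK hK (thompsonTP g).
by exists (Sub h (asboolT hT)).
Qed.

Definition thompsonT_one : thompsonT := Sub id (asboolT in_thompsonT_id).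
Definition thompsonT_mul (g h : thompsonT) : thompsonT :=
  Sub (val g \o val h)
    (asboolT (in_thompsonT_comp (thompsonTP g) (thompsonTP h))).
Definition thompsonT_inv (g : thompsonT) : thompsonT :=
  projT1 (cid (thompsonT_inv_ex g)).

Lemma thompsonT_eq (g h : thompsonT) : val g =1 val h -> g = h.
Proof. by move=> gh; apply: val_inj; exact/funext. Qed.

Lemma thompsonT_mulA : associative thompsonT_mul.
Proof. by move=> g h k; exact: thompsonT_eq. Qed.
Lemma thompsonT_mul1 : left_id thompsonT_one thompsonT_mul.
Proof. by move=> g; exact: thompsonT_eq. Qed.
Lemma thompsonT_1mul : right_id thompsonT_one thompsonT_mul.
Proof. by move=> g; exact: thompsonT_eq. Qed.
Lemma thompsonT_mulV : left_inverse thompsonT_one thompsonT_inv thompsonT_mul.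
Proof.
move=> g; apply: thompsonT_eq => x; rewrite /thompsonT_inv /=.
by case: cid => h [gK hK] /=; exact: gK.
Qed.
Lemma thompsonT_Vmul : right_inverse thompsonT_one thompsonT_inv thompsonT_mul.
Proof.
move=> g; apply: thompsonT_eq => x; rewrite /thompsonT_inv /=.
by case: cid => h [gK hK] /=; exact: hK.
Qed.

HB.instance Definition _ := isGroup.Build thompsonT thompsonT_mulA
  thompsonT_mul1 thompsonT_1mul thompsonT_mulV thompsonT_Vmul.

Definition fixes0 : pred thompsonT :=
  [pred g | val g (circle_pt 0) == circle_pt 0].

Lemma fixes0_group_closed : group_closed fixes0.
Proof.
split=> [|g h]; rewrite !inE//= => /eqP g0 /eqP h0; apply/eqP.
have /(congr1 (fun k : thompsonT => val k (circle_pt 0))) /= := mulVg h.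
by rewrite h0 => ->.
Qed.

Definition thompsonF : Type := {g : thompsonT | fixes0 g}.
HB.instance Definition _ := [isSub of thompsonF for @sval _ _].
HB.instance Definition _ := [Choice of thompsonF by <:].
HB.instance Definition _ := SubChoice_isSubGroup.Build _ _ thompsonF
  fixes0_group_closed.

Lemma dyadic_act_subproof (g : thompsonT) (x : dyadic R) :
  val g (val x) \in dyadic R.
Proof.
have [_ gD _] := thompsonTP g.
have xD : dyadic R (val x) by have := valP x; rewrite inE.
by move: (val x) xD => p pD; rewrite inE -gD; exists p.
Qed.

Definition dyadic_act (g : thompsonT) (x : dyadic R) : dyadic R :=
  exist _ (val g (val x)) (dyadic_act_subproof g x).

Lemma dyadic_actM (g h : thompsonT) x :
  dyadic_act (g * h)%g x = dyadic_act g (dyadic_act h x).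
Proof. exact: val_inj. Qed.

Lemma dyadic_act1 x : dyadic_act 1%g x = x.
Proof. exact: val_inj. Qed.

Lemma dyadic_actK (g : thompsonT) : cancel (dyadic_act g) (dyadic_act g^-1%g).
Proof. by move=> x; rewrite -dyadic_actM mulVg dyadic_act1. Qed.

(* (lambda_rep g u)(t) = u(g^-1 t), (pi_rep g u)(x) = u(g^-1 . x); the lemmas
   lambda_rep_delta and pi_rep_delta give the action on basis vectors. *)
Definition lambda_rep (g : thompsonT) : bop (l2 R thompsonT) :=
  comp_op R (mulgI g^-1%g).

Definition pi_rep (g : thompsonT) : bop (l2 R (dyadic R)) :=
  comp_op R (can_inj (dyadic_actK g^-1%g)).

Lemma lambda_rep_delta (g t : thompsonT) :
  val (lambda_rep g) (l2_delta R t) = l2_delta R (g * t)%g.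
Proof.
by rewrite (@comp_op_delta _ _ _ (fun x => (g * x)%g))//; [exact: mulVKg|exact: mulKg].
Qed.

Lemma pi_rep_delta (g : thompsonT) (x : dyadic R) :
  val (pi_rep g) (l2_delta R x) = l2_delta R (dyadic_act g x).
Proof.
rewrite (@comp_op_delta _ _ _ (dyadic_act g))//; last exact: dyadic_actK.
by move=> y; rewrite -dyadic_actM mulgV dyadic_act1.
Qed.

(* The image of the group algebra: finite linear combinations of the
   lambda_rep g. *)
Definition lambda_group_algebra : set (bop (l2 R thompsonT)) :=
  [set a | exists (s : seq thompsonT) (c : thompsonT -> R[i]),
    a = \sum_(g <- s) c g *: lambda_rep g].

Definition Cstar_red : set (bop (l2 R thompsonT)) :=
  closure lambda_group_algebra.

End ThompsonT.
Arguments lambda_group_algebra R : clear implicits.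
Arguments Cstar_red R : clear implicits.

Section Ideals.
Variables (R : realType) (V : normedModType R[i]).
Implicit Types (A J : set (bop V)) (a b : bop V).

(* Closed two-sided ideals of the subalgebra A; for norm-closed A, being closed
   in A and being closed in B(V) agree. *)
Definition closed_ideal A J : Prop :=
  [/\ J `<=` A, closed J, J 0, (forall a b, J a -> J b -> J (a + b)) &
      [/\ forall (c : R[i]) a, J a -> J (c *: a),
          forall a b, A a -> J b -> J (a * b) &
          forall a b, A a -> J b -> J (b * a)]].

Definition closed_ideal_gen A a : set (bop V) :=
  \bigcap_(J in [set J | closed_ideal A J /\ J a]) J.

End Ideals.

(* Main.v *)
Require Import Defs.
From mathcomp Require Import all_boot all_order all_algebra.
From mathcomp Require Import finmap.
From mathcomp Require Import boolp classical_sets functions cardinality fsbigop.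
From mathcomp Require Import reals ereal topology normedtype.
From mathcomp Require Import sequences esum.
From mathcomp Require Import ring lra.
From mathcomp Require Import complex.

Set Implicit Arguments.
Unset Strict Implicit.
Unset Printing Implicit Defensive.

Import Order.TTheory GRing.Theory Num.Theory.
Import numFieldNormedType.Exports.

(** Why the theorem holds.

    If [F] is amenable, the trivial representation of [F] is weakly contained
    in its regular representation, so pi, the quasi-regular representation of
    [T] on [T / F], is weakly contained in lambda.  Hence the elements of the
    group algebra killed by pi have a lambda-image whose closure is a proper
    ideal, and it contains every difference of sums with equal images under
    pi.  Concretely, [amenable_folner] turns the mean into Folner sets, by
    Hall's theorem and a paradoxical decomposition, and [folner_kernel_far]
    tests [1 - x], for [x] in the kernel, on the indicator of a Folner set: the
    norm of [1 - x] is at least 1/2.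

    If [F] is not amenable, take [a] and [b] in [T] with supports in opposite
    half-circles.  Every point is fixed by [a] or by [b], so that
    [1 + pi (a * b) = pi a + pi b], and the corresponding element for lambda is
    [(1 - lam a) * (1 - lam b)].  Suppose that [a] moves an arc [I] off itself,
    and let [iota] be a copy of [F] supported in [I].  The commutators of [a]
    with the [iota f] act on [I] like arbitrary elements of the copy of [F].
    Therefore they inherit a spectral gap from [F]
    ([spectral_gap_of_nonamenable]): an average [M] of [1] and of finitely many
    of them has norm less than 1.  Since [b] commutes with the copy of [F], the
    ideal generated by [(1 - lam a) * (1 - lam b)] contains
    [(1 - M) * (1 - lam b)], hence [1 - lam b] because [1 - M] is invertible
    ([ideal_propagation]).  The same argument with [b], which moves an arc of
    the other half-circle off itself, shows that the ideal contains [1].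

    What remains is to produce such elements of [T] ([unit_pl_realize],
    [insertion], [displacing_element]): [a] and [b] are the standard generator
    of [F] rescaled to each of the half-circles. *)

(** * Hall's marriage theorem *)

Section Hall.
Variables (X Y : choiceType) (y0 : Y).
Local Open Scope fset_scope.
Local Open Scope nat_scope.

Lemma fbigcupP (N : X -> {fset Y}) (B : {fset X}) y :
  reflect (exists2 x, x \in B & y \in N x) (y \in \bigcup_(x <- B) N x).
Proof.
apply: (iffP (bigfcupP _ _ _ _)) => [[x /andP[xB _] yN]|[x xB yN]]; exists x => //.
by rewrite andbT.
Qed.

(** The count behind the tight case of Hall's theorem: what [B `|` C] sees is
    covered by what [B] sees and what [C] sees outside of that. *)
Lemma bigfcup_split (N : X -> {fset Y}) (B C : {fset X}) y :
  y \in \bigcup_(x <- B `|` C) N x ->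
  y \in (\bigcup_(x <- C) (N x `\` \bigcup_(x <- B) N x)) `|`
        \bigcup_(x <- B) N x.
Proof.
move=> /fbigcupP[x + yN]; rewrite !in_fsetU => /orP[xB|xC].
  by apply/orP; right; apply/fbigcupP; exists x.
apply/orP; case: (boolP (y \in \bigcup_(x <- B) N x)) => yB; first by right.
by left; apply/fbigcupP; exists x; rewrite // in_fsetD yB.
Qed.

(** Halmos-Vaughan induction on the size of [A].  If some proper nonempty
    subset is tight (it sees exactly as many points as it has), match it by
    itself and match the rest into the unseen points; otherwise there is one
    unit of slack everywhere and an arbitrary first choice does no harm. *)
Lemma hall_marriage (N : X -> {fset Y}) (A : {fset X}) :
  (forall B, B `<=` A -> #|` B| <= #|` \bigcup_(x <- B) N x|) ->
  exists f : X -> Y,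
    (forall x, x \in A -> f x \in N x) /\ {in A &, injective f}.
Proof.
have [n] := ubnP #|` A|; elim: n N A => // n IH N A /ltnSE An HA.
have [A0|[x xA]] := fset_0Vmem A; first by exists (fun=> y0); split => [x|x y]; rewrite A0 ?inE.
have [tight|loose] := pselect (exists B, [/\ B `<` A, B != fset0 &
    #|` \bigcup_(x <- B) N x| <= #|` B|]).
  move: tight => [B [BA B0 NB]].
  have sBA := fproper_sub BA.
  have [f1 [f1N f1i]] : exists f : X -> Y,
      (forall x, x \in B -> f x \in N x) /\ {in B &, injective f}.
    apply: IH; first by rewrite (leq_trans (fproper_ltn_card BA)).
    by move=> C CB; apply: HA; exact: fsubset_trans CB sBA.
  have [f2 [f2N f2i]] : exists f : X -> Y,
      (forall x, x \in A `\` B -> f x \in N x `\` \bigcup_(x <- B) N x) /\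
      {in A `\` B &, injective f}.
    apply: IH.
      rewrite (leq_trans _ An)// fproper_ltn_card// fproperEneq fsubsetDl andbT.
      apply: contraNneq B0 => AB; rewrite -cardfs_eq0.
      have := cardfsID B A; rewrite AB -[RHS]add0n => /addIn.
      by rewrite (fsetIidPr sBA) => ->.
    move=> C CAB.
    have CA : C `<=` A := fsubset_trans CAB (fsubsetDl _ _).
    have BC0 : B `&` C = fset0.
      apply/fsetP => z; rewrite !inE; apply/negP => /andP[zB zC].
      by move/fsubsetP: CAB => /(_ z zC); rewrite !inE zB.
    have := HA (B `|` C); rewrite fsubUset sBA CA => /(_ isT).
    have := cardfsUI B C; rewrite BC0 cardfs0 addn0 => ->.
    move=> h; rewrite -(leq_add2l #|` B|); apply: (leq_trans h).
    apply: (@leq_trans #|` (\bigcup_(x <- C) (N x `\` \bigcup_(x <- B) N x)) `|`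
        \bigcup_(x <- B) N x|).
      by apply: fsubset_leq_card; apply/fsubsetP => z /bigfcup_split.
    rewrite addnC (leq_trans _ (leq_add (leqnn _) NB))//.
    by rewrite cardfsU leq_subr.
  exists (fun x => if x \in B then f1 x else f2 x); split => [z zA|z w zA wA].
    case: ifP => zB; first exact: f1N.
    by have := f2N z; rewrite in_fsetD zB zA in_fsetD => /(_ isT) /andP[].
  have key u v : u \in B -> v \in A -> v \notin B -> f1 u = f2 v -> False.
    move=> uB vA vB E; have := f2N v; rewrite in_fsetD vB vA in_fsetD => /(_ isT).
    move=> /andP[/negP + _]; apply; rewrite -E; apply/fbigcupP; exists u => //.
    exact: f1N.
  case: ifP => zB; case: ifP => wB E.
  - exact: f1i.
  - by case: (key z w) => //; rewrite wB.
  - by case: (key w z) => //; rewrite zB.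
  - by apply: f2i; rewrite // in_fsetD ?zB ?wB.
have [y yN] : exists y, y \in N x.
  apply/fset0Pn; rewrite -cardfs_gt0.
  have := HA [fset x]; rewrite fsub1set xA cardfs1 => /(_ isT).
  by rewrite big_seq_fset1.
have [f [fN fi]] : exists f : X -> Y,
    (forall z, z \in A `\ x -> f z \in N z `\ y) /\ {in A `\ x &, injective f}.
  apply: IH; first by rewrite (leq_trans _ An)// fproper_ltn_card// fproperD1.
  move=> B BAx; have [->|B0] := eqVneq B fset0; first by rewrite cardfs0.
  have BA := fsub_proper_trans BAx (fproperD1 xA).
  have lt : #|` B| < #|` \bigcup_(x <- B) N x|.
    by rewrite ltnNge; apply/negP => NB; apply: loose; exists B.
  have -> : \bigcup_(z <- B) (N z `\ y) = (\bigcup_(z <- B) N z) `\ y.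
    apply/fsetP => z; rewrite in_fsetD1; apply/fbigcupP/andP => [[w wB]|[zy /fbigcupP[w wB wz]]].
      by rewrite in_fsetD1 => /andP[-> wz]; split=> //; apply/fbigcupP; exists w.
    by exists w => //; rewrite in_fsetD1 zy.
  by move: lt; rewrite (cardfsD1 y); case: (y \in _) => //= /ltnW.
exists (fun z => if z == x then y else f z); split => [z zA|z w zA wA].
  case: eqVneq => [->//|zx].
  by have := fN z; rewrite !in_fsetD1 zx zA => /(_ isT) /andP[].
case: eqVneq => zx; case: eqVneq => wx.
- by rewrite zx wx.
- by move=> E; have := fN w; rewrite !in_fsetD1 wx wA -E eqxx => /(_ isT).
- by move=> E; have := fN z; rewrite !in_fsetD1 zx zA E eqxx => /(_ isT).
- by move=> E; apply: fi; rewrite // in_fsetD1 ?zx ?wx.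
Qed.

End Hall.

(** * Ultrafilters on finite subsets *)

Section UltraFinite.
Local Open Scope classical_set_scope.
Local Open Scope fset_scope.

(** Ultralimits along such a [U] turn a property that can be met on every
    finite set of instances into one that is met on all of them: each
    prescribed instance is eventually among those treated. *)
Lemma ultra_of_fsets (X : choiceType) :
  exists U : set_system {fset X}, UltraFilter U /\
    forall x, U [set B : {fset X} | x \in B].
Proof.
pose cone (B : {fset X}) := [set C : {fset X} | B `<=` C].
have PF : ProperFilter (filter_from setT cone).
  apply: filter_from_proper; last by move=> B _; exists B; rewrite /cone /=.
  apply: filter_fromT_filter; first by exists fset0.
  move=> B C; exists (B `|` C) => D /=; rewrite /cone /= fsubUset.
  by move=> /andP[].
have [U [UU sU]] := ultraFilterLemma PF.
exists U; split=> // x; apply: sU; exists [fset x] => // B.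
by rewrite /cone /= fsub1set.
Qed.

Lemma ultra_finite_choice (T : Type) (K : choiceType) (U : set_system T)
  (ks : seq K) (P : K -> set T) : UltraFilter U ->
  U [set t | exists2 k, k \in ks & P k t] -> exists2 k, k \in ks & U (P k).
Proof.
move=> UU; elim: ks => [|k ks IH] UP.
  by have /filter_ex[t [k]] := UP.
have [Uk|nUk] := in_ultra_setVsetC (P k) UU; first by exists k; rewrite ?mem_head.
have [|j jks Uj] := IH; last by exists j; rewrite // in_cons jks orbT.
apply: filterS (filterI UP nUk) => t [[j + Pj] nPk].
by rewrite in_cons => /orP[/eqP jk|jks]; [rewrite jk in Pj|exists j].
Qed.

End UltraFinite.

(** * From an invariant mean to Folner sets *)

Section Folner.
Variables (R : realType) (G : groupType).
Implicit Types (A B K S : {fset G}).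
Local Open Scope fset_scope.

Definition translates K A : {fset G} := \bigcup_(t <- A) [fset (k * t)%g | k in K].

Lemma translatesP K A x :
  reflect (exists k t, [/\ k \in K, t \in A & x = (k * t)%g]) (x \in translates K A).
Proof.
apply: (iffP (fbigcupP _ _ _)) => [[t tA /imfsetP[k /= kK ->]]|[k [t [kK tA ->]]]].
  by exists k, t.
by exists t => //; apply/imfsetP; exists k.
Qed.

Lemma translates1 A : translates [fset 1%g] A = A.
Proof.
apply/fsetP => x; apply/translatesP/idP => [[k [t [+ tA ->]]]|xA].
  by rewrite in_fset1 => /eqP ->; rewrite mul1g.
by exists 1%g, x; rewrite mul1g in_fset1.
Qed.

Lemma translatesM K L A : translates (translates K L) A = translates K (translates L A).
Proof.
apply/fsetP => x; apply/translatesP/translatesP.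
  move=> [k [t [/translatesP[k' [l [k'K lL ->]]] tA ->]]].
  exists k', (l * t)%g; rewrite mulgA; split=> //; apply/translatesP.
  by exists l, t.
move=> [k [t [kK /translatesP[l [a [lL aA ->]]] ->]]].
exists (k * l)%g, a; rewrite mulgA; split=> //; apply/translatesP.
by exists k, l.
Qed.

Definition folner : Prop := forall S (e : R), (0 < e)%R ->
  exists2 A, A != fset0 & forall s, s \in S ->
    (#|` [fset (s * t)%g | t in A] `\` A|%:R <= e * #|` A|%:R)%R.

(** If some [S] moves every finite set by a proportion at least [e], then
    multiplying by [1 |` S] enlarges every finite set by the factor [1 + e];
    iterating, a power of [1 |` S] doubles every finite set. *)
Lemma nfolner_doubling : ~ folner ->
  exists K, forall A, (2 * #|` A| <= #|` translates K A|)%N.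
Proof.
move=> nF.
have [S [e [e0 Se]]] : exists S (e : R), (0 < e)%R /\ forall A, A != fset0 ->
    exists2 s, s \in S &
      (e * #|` A|%:R < #|` [fset (s * t)%g | t in A] `\` A|%:R)%R.
  apply: contrapT => nSe; apply: nF => S e e0; apply: contrapT => nA.
  apply: nSe; exists S, e; split=> // A A0; apply: contrapT => ns; apply: nA.
  exists A => // s sS; rewrite leNgt; apply/negP => lt; apply: ns.
  by exists s.
pose S1 := 1%g |` S.
have step A : ((1 + e) * #|` A|%:R <= #|` translates S1 A|%:R :> R)%R.
  have [->|A0] := eqVneq A fset0; first by rewrite cardfs0 mulr0.
  have [s sS lt] := Se A A0.
  have sub : A `|` ([fset (s * t)%g | t in A] `\` A) `<=` translates S1 A.
    apply/fsubsetP => x; rewrite in_fsetU => /orP[xA|].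
      by apply/translatesP; exists 1%g, x; rewrite mul1g !inE eqxx.
    rewrite in_fsetD => /andP[_ /imfsetP[t /= tA ->]].
    by apply/translatesP; exists s, t; rewrite !inE sS orbT.
  apply: (le_trans _ (_ : #|` A `|` ([fset (s * t)%g | t in A] `\` A)|%:R <= _)%R);
    last by rewrite ler_nat fsubset_leq_card.
  rewrite -[X in (_ <= X%:R)%R]addn0 -[X in (_ + X)%N](cardfs0 G).
  rewrite (_ : fset0 = A `&` ([fset (s * t)%g | t in A] `\` A)); last first.
    by apply/fsetP => x; rewrite !inE; case: (x \in A).
  by rewrite cardfsUI natrD mulrDl mul1r lerD2l ltW.
have iter (n : nat) : exists K, forall A,
    ((1 + n%:R * e) * #|` A|%:R <= #|` translates K A|%:R :> R)%R.
  elim: n => [|n [K HK]].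
    by exists [fset 1%g] => A; rewrite translates1 mul0r addr0 mul1r.
  exists (translates S1 K) => A; rewrite translatesM.
  apply: le_trans (step _); apply: le_trans (_ : _ <= (1 + e) * ((1 + n%:R * e) * #|` A|%:R))%R _; last first.
    by rewrite ler_wpM2l// addr_ge0 ?ler01// ltW.
  rewrite mulrA ler_wpM2r ?ler0n// -natr1.
  have : (0 <= n%:R * (e * e) :> R)%R by rewrite mulr_ge0 ?ler0n// mulr_ge0// ltW.
  by nra.
have [K HK] := iter (Num.Def.truncn e^-1).+1; exists K => A.
rewrite -(@ler_nat R) natrM; apply: le_trans (HK A); rewrite ler_wpM2r ?ler0n//.
have : (1 <= (Num.Def.truncn e^-1).+1%:R * e)%R.
  by rewrite -ler_pdivrMr// div1r ltW// truncnS_gt.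
by lra.
Qed.

(** Doubling is Hall's condition for matching each of the two copies of [t]
    with a point of [translates K [fset t]].  Hall's theorem gives this over
    finite sets of [t]; since [K] is finite, the displacement [f B x] of a
    given [x] has an ultralimit as [B] grows, and injectivity passes to it. *)
Lemma doubling_matching K :
  (forall A, (2 * #|` A| <= #|` translates K A|)%N) ->
  exists k : G * bool -> G, (forall x, k x \in K) /\
    injective (fun x => k x * x.1)%g.
Proof.
move=> dbl.
have fin B : exists f : G * bool -> G,
    (forall x, x.1 \in B -> f x \in [fset (k * x.1)%g | k in K]) /\
    (forall x y, x.1 \in B -> y.1 \in B -> f x = f y -> x = y).
  pose B2 : {fset G * bool} := B `*` [fset true; false].
  have inB2 x : (x \in B2) = (x.1 \in B).
    by rewrite in_fsetM !inE; case: x.2; rewrite andbT.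
  have [C CB|f [fN fi]] :=
      @hall_marriage _ _ 1%g (fun x => [fset (k * x.1)%g | k in K]) B2.
    pose D := [fset x.1 | x in C].
    have CD : C `<=` D `*` [fset true; false].
      apply/fsubsetP => x xC; rewrite in_fsetM; apply/andP; split.
        by apply/imfsetP; exists x.
      by rewrite !inE; case: x.2.
    apply: (@leq_trans (2 * #|` D|)%N).
      rewrite (leq_trans (fsubset_leq_card CD))//.
      have -> : D `*` [fset true; false] =
          [fset (d, true) | d in D] `|` [fset (d, false) | d in D].
        apply/fsetP => -[d b]; rewrite in_fsetM in_fsetU !inE /=.
        apply/andP/orP => [[dD]|].
          by case: b => _; [left|right]; apply/imfsetP; exists d.
        by case=> /imfsetP[d' /= d'D [-> ->]].
      rewrite mul2n -addnn cardfsU (leq_trans (leq_subr _ _))//.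
      by rewrite leq_add//; exact: leq_imfset_card.
    apply: (leq_trans (dbl D)); apply: fsubset_leq_card.
    apply/fsubsetP => y /translatesP[k [t [kK /imfsetP[x /= xC ->] ->]]].
    by apply/fbigcupP; exists x => //; apply/imfsetP; exists k.
  exists f; split=> [x xB|x y xB yB]; first by apply: fN; rewrite inB2.
  by apply: fi; rewrite inB2.
have [f fP] := choice fin.
have [U [UU Ux]] := ultra_of_fsets G.
have lim x : exists2 k, k \in enum_fset K & U [set B : {fset G} | f B x = (k * x.1)%g]%classic.
  apply: ultra_finite_choice.
  apply: filterS (Ux x.1) => B /= xB.
  by have [/(_ x xB)/imfsetP[k /= kK E] _] := fP B; exists k.
have /choice[k kP] : forall x, exists k, k \in K /\ U [set B : {fset G} | f B x = (k * x.1)%g]%classic.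
  by move=> x; have [k kK Uk] := lim x; exists k.
exists k; split=> [x|x y E]; first by have [] := kP x.
have [[_ Ukx] [_ Uky]] := (kP x, kP y).
have /filter_ex[B [[/= Bx By] [xB yB]]] : U
    ([set B | f B x = (k x * x.1)%g] `&` [set B | f B y = (k y * y.1)%g] `&`
     ([set B : {fset G} | x.1 \in B] `&` [set B : {fset G} | y.1 \in B]))%classic.
  by apply: filterI; apply: filterI; [exact: Ukx|exact: Uky|exact: Ux|exact: Ux].
by have [_ fi] := fP B; apply: fi => //; rewrite Bx By.
Qed.

End Folner.

Section AmenableFolner.
Variables (R : realType) (G : groupType).
Local Open Scope classical_set_scope.
Local Open Scope ring_scope.

(** Cut [A] along the finitely many values of [k]; on each piece the map is a
    left translation. *)
Lemma mean_piecewise_translate (mu : set G -> R) (k : G -> G) (ks : seq G) :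
  (forall A B, A `&` B = set0 -> mu (A `|` B) = mu A + mu B) ->
  (forall g A, mu ((fun x => (g * x)%g) @` A) = mu A) ->
  injective (fun t => k t * t)%g ->
  forall A, (forall t, A t -> k t \in ks) ->
  mu ((fun t => k t * t)%g @` A) = mu A.
Proof.
move=> muU mug ki; elim: ks => [|j ks IH] A Ak.
  by have -> : A = set0; [rewrite -subset0 => t /Ak; rewrite in_nil|rewrite image_set0].
pose A1 := A `&` [set t | k t = j]; pose A2 := A `&` [set t | k t <> j].
have EA : A = A1 `|` A2.
  apply/seteqP; split=> [t At|t [[]|[]]//].
  by have [E|E] := pselect (k t = j); [left|right].
rewrite EA image_setU !muU.
- rewrite (IH A2) => [|t [/Ak + ktj]]; last by rewrite inE => /orP[/eqP|].
  congr (_ + _); rewrite -[RHS](mug j); congr mu.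
  by apply/seteqP; split=> _ [t [At kt] <-]; exists t => //=; rewrite ?kt.
- by rewrite -subset0 => _ [[t [_ /= tj] <-] [u [_ /= uj] /ki E]]; apply: uj; rewrite E.
- by rewrite -subset0 => t [[_ /= tj] [_ /= ntj]]; exact: ntj.
Qed.

(** Without Folner sets the matching above embeds two disjoint copies of [G],
    each of full measure, in [G]: a paradoxical decomposition. *)
Lemma amenable_folner : amenable R G -> folner R G.
Proof.
move=> [mu [mu1 mu0 muU mug]]; apply: contrapT => /nfolner_doubling[K].
move=> /doubling_matching[k [kK ki]].
have half b : mu ((fun t => k (t, b) * t)%g @` [set: G]) = 1.
  rewrite (@mean_piecewise_translate mu (fun t => k (t, b)) (enum_fset K))//.
  by move=> t u E; have [] := ki (t, b) (u, b) E.
pose A b := (fun t => k (t, b) * t)%g @` [set: G].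
have : mu [set: G] >= mu (A true `|` A false).
  by rewrite -(setUv (A true `|` A false)) [leRHS]muU ?lerDl ?setICr.
rewrite muU ?half ?mu1; first by lra.
rewrite -subset0 => _ [[t _ <-] [u _ E]].
by have [] := ki (u, false) (t, true) E.
Qed.

End AmenableFolner.

(** * Restriction and parallelogram law in l2 *)

Section L2Tools.
Variables (R : realType) (X : choiceType).
Implicit Types (u v : l2 R X) (B : set X).
Local Open Scope classical_set_scope.
Local Open Scope ring_scope.

Lemma l2_sqnorm_restr B (u : X -> R[i]) :
  l2_sqnorm (fun x => if x \in B then u x else 0) =
  (\esum_(x in B) ((Normc.normc (u x)) ^+ 2)%:E)%E.
Proof.
rewrite [RHS]esum_mkcond; apply: eq_esum => x _.
by case: ifP => _ //; rewrite Normc.normc0 expr0n.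
Qed.

Lemma square_summable_restr B u :
  `[< square_summable (fun x => if x \in B then val u x else 0) >].
Proof.
apply/asboolP; apply: le_lt_trans (asboolW (valP u)).
by apply: le_esum => x _; case: ifP => _ //; rewrite Normc.normc0 expr0n lee_fin sqr_ge0.
Qed.

Definition l2_restr B u : l2 R X :=
  Sub (fun x => if x \in B then val u x else 0) (square_summable_restr B u).

Lemma l2_restrE B u x : val (l2_restr B u) x = if x \in B then val u x else 0.
Proof. by []. Qed.

Lemma l2_eq u v : val u =1 val v -> u = v.
Proof. by move=> uv; apply: val_inj; exact/funext. Qed.

Lemma l2_addE u v x : val (u + v) x = val u x + val v x.
Proof. by rewrite raddfD. Qed.

Lemma l2_oppE u x : val (- u) x = - val u x.
Proof. by rewrite raddfN. Qed.

Lemma l2_scaleE c u x : val (c *: u) x = c * val u x.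
Proof. by rewrite linearZ. Qed.

Lemma l2_zeroE x : val (0 : l2 R X) x = 0.
Proof. by rewrite raddf0. Qed.

Lemma l2_restrB B u v : l2_restr B (u - v) = l2_restr B u - l2_restr B v.
Proof.
apply: l2_eq => x; rewrite l2_addE l2_oppE !l2_restrE l2_addE l2_oppE.
by case: ifP; rewrite ?subr0.
Qed.

Lemma l2_restrT u : l2_restr setT u = u.
Proof. by apply: l2_eq => x; rewrite l2_restrE in_setT. Qed.

Lemma l2_sqnorm_le u v :
  (l2_sqnorm (val u) <= l2_sqnorm (val v))%E -> l2_norm u <= l2_norm v.
Proof. by rewrite [X in (_ <= X)%E]l2_sqnormE; apply: l2_norm_le; exact: l2_norm_ge0. Qed.

Lemma l2_norm_restr_le B u : l2_norm (l2_restr B u) <= l2_norm u.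
Proof.
apply: l2_sqnorm_le; apply: le_esum => x _ /=.
by case: ifP => _ //; rewrite Normc.normc0 expr0n lee_fin sqr_ge0.
Qed.

Lemma l2_norm_restrU B C u : B `&` C = set0 ->
  l2_norm (l2_restr (B `|` C) u) ^+ 2 =
  l2_norm (l2_restr B u) ^+ 2 + l2_norm (l2_restr C u) ^+ 2.
Proof.
move=> BC; apply: EFin_inj; rewrite EFinD -!l2_sqnormE !l2_sqnorm_restr.
rewrite (esumID B) => [|x _]; last by rewrite lee_fin sqr_ge0.
congr (_ + _)%E; congr esum.
  by rewrite setIUl setIid setUidl// => x [].
rewrite setIUl setICr set0U; apply/setIidPl => x Cx Bx.
by have : (B `&` C) x by []; rewrite BC.
Qed.

Lemma normcD_parallelogram (a b : R[i]) :
  Normc.normc (a + b) ^+ 2 + Normc.normc (a - b) ^+ 2 =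
  (Normc.normc a ^+ 2 + Normc.normc a ^+ 2) +
  (Normc.normc b ^+ 2 + Normc.normc b ^+ 2).
Proof.
case: a b => [a1 a2] [b1 b2] /=.
by rewrite !sqr_sqrtr ?addr_ge0 ?sqr_ge0//; ring.
Qed.

Lemma l2_parallelogram u v :
  l2_norm (u + v) ^+ 2 + l2_norm (u - v) ^+ 2 =
  2 * l2_norm u ^+ 2 + 2 * l2_norm v ^+ 2.
Proof.
rewrite !(mulr_natl _ 2) !mulr2n; apply: EFin_inj.
rewrite !EFinD -!l2_sqnormE /l2_sqnorm -!esumD; try by move=> x _; rewrite ?adde_ge0 ?lee_fin ?sqr_ge0.
apply: eq_esum => x _.
by rewrite -!EFinD l2_addE l2_addE l2_oppE normcD_parallelogram.
Qed.

Lemma l2_normN u : l2_norm (- u) = l2_norm u.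
Proof. by apply: complexI; exact: (normrN u). Qed.

Lemma l2_norm_sum (I : Type) (s : seq I) (F : I -> l2 R X) :
  l2_norm (\sum_(i <- s) F i) <= \sum_(i <- s) l2_norm (F i).
Proof.
elim: s => [|i s IH]; last by rewrite !big_cons (le_trans (l2_normD _ _))// lerD2l.
by rewrite !big_nil -(scale0r 0) l2_normZ Normc.normc0 mul0r.
Qed.

Lemma l2_norm_comp (h k : X -> X) (hi : injective h) u :
  cancel k h -> l2_norm (l2_comp hi u) = l2_norm u.
Proof.
move=> kK; have ki := can_inj kK.
apply/eqP; rewrite eq_le; apply/andP; split; apply: l2_sqnorm_le.
  exact: l2_sqnorm_comp.
have := l2_sqnorm_comp (val (l2_comp hi u)) ki.
by congr (l2_sqnorm _ <= _)%E; apply/funext => x /=; rewrite kK.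
Qed.

Lemma l2_restr_comp (h : X -> X) (hi : injective h) B u :
  l2_restr B (l2_comp hi u) = l2_comp hi (l2_restr (h @` B) u).
Proof.
apply: l2_eq => x /=; congr (if _ then _ else _); apply/idP/idP; rewrite !inE.
  by exists x.
by move=> [y yB /hi <-].
Qed.

End L2Tools.

(** * Almost invariant vectors and the spectral gap *)

(** [F] acts on [X] only through the family of permutations [h f], which need
    not compose like the elements of [F]; all that ties them to [F] is that [p]
    carries [h f] to the left translation by [f]. *)
Section AlmostInvariant.
Variables (R : realType) (F : groupType) (X : choiceType).
Variables (h k : F -> X -> X) (p : X -> F).
Hypotheses (hK : forall f, cancel (h f) (k f)) (kK : forall f, cancel (k f) (h f)).
Hypothesis pE : forall f x, p (h f x) = (f * p x)%g.
Local Open Scope classical_set_scope.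
Local Open Scope ring_scope.
Local Open Scope complex_scope.

Let hi f : injective (h f) := can_inj (hK f).

Let weight (u : l2 R X) (A : set F) : R := l2_norm (l2_restr (p @^-1` A) u) ^+ 2.

Let weight_translate u f A e : l2_norm u = 1 ->
  l2_norm (l2_comp (@hi f) u - u) <= e ->
  `|weight u ((fun x => (f * x)%g) @` A) - weight u A| <= 2 * e.
Proof.
move=> u1 ue; pose P := p @^-1` A.
have EP : p @^-1` ((fun x => (f * x)%g) @` A) = h f @` P.
  apply/seteqP; split=> [x /= [a Aa fa]|_ [x Px <-] /=].
    exists (k f x); last exact: kK.
    rewrite /P /=; suff <- : a = p (k f x) by [].
    by apply: (@mulgI _ f); rewrite fa -pE kK.
  by rewrite pE; exists (p x).
rewrite /weight EP -(l2_norm_comp (@hi f) _ (@kK f)) -l2_restr_comp.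
set a := l2_norm _; set b := l2_norm (l2_restr P u).
have a0 : 0 <= a := l2_norm_ge0 _.
have b0 : 0 <= b := l2_norm_ge0 _.
have a1 : a <= 1.
  by rewrite -u1 -(l2_norm_comp (@hi f) u (@kK f)) l2_norm_restr_le.
have b1 : b <= 1 by rewrite -u1 l2_norm_restr_le.
have ab : `|a - b| <= e.
  have D := l2_norm_restr_le P (l2_comp (@hi f) u - u).
  rewrite l2_restrB in D; have {}D := le_trans D ue.
  have D1 := l2_normD (l2_restr P (l2_comp (@hi f) u) - l2_restr P u) (l2_restr P u).
  have D2 := l2_normD (l2_restr P u - l2_restr P (l2_comp (@hi f) u))
                      (l2_restr P (l2_comp (@hi f) u)).
  rewrite subrK -/a -/b in D1; rewrite subrK -/a -/b -opprB l2_normN in D2.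
  by rewrite ler_norml; apply/andP; split; lra.
rewrite subr_sqr normrM mulrC; apply: ler_pM => //.
by rewrite ger0_norm ?addr_ge0//; lra.
Qed.

(** For a unit vector [u] the squared modulus is a probability on [X], and
    [weight u] is its image in [F] under [p]; it is almost invariant when [u]
    is.  An ultralimit of these probabilities is an invariant mean.  A pair
    [(f, n)] in [B] asks for invariance under [f] up to [1 / (n + 1)]. *)
Lemma amenable_of_almost_invariant :
  (forall B : {fset F * nat}, exists u : l2 R X, l2_norm u = 1 /\
    forall x, x \in B -> l2_norm (l2_comp (@hi x.1) u - u) <= x.2.+1%:R^-1) ->
  amenable R F.
Proof.
move=> /choice[u uP].
have [U [UU Ux]] := ultra_of_fsets (F * nat)%type.
have u1 B : l2_norm (u B) = 1 by have [] := uP B.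
have w01 B A : 0 <= weight (u B) A <= 1.
  rewrite sqr_ge0 -(expr1n R 2) ler_pXn2r ?nnegrE ?ler01 ?l2_norm_ge0//.
  by rewrite -(u1 B) l2_norm_restr_le.
have lim A : exists l : R, forall e, 0 < e -> U [set B | `|weight (u B) A - l| < e].
  have [|l [_ cl]] := @segment_compact R 0 1 ((fun B => weight (u B) A) @ U).
    have : U [set B | weight (u B) A \in `[0, 1]] by apply: filterE => B; rewrite /= in_itv; exact: w01.
    exact.
  exists l => e e0.
  have [//|far] := in_ultra_setVsetC [set B | `|weight (u B) A - l| < e] UU.
  have [||r [/= rfar]] := cl [set r | ~ `|r - l| < e] (ball l e).
  - exact: far.
  - exact: nbhsx_ballx.
  by rewrite /ball /= distrC => /rfar.
have /choice[mu muP] := lim.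
have close x y : (forall e, 0 < e -> `|x - y| <= 4 * e) -> x = y :> R.
  move=> xy; apply/eqP; rewrite -subr_eq0 -normr_le0 leNgt; apply/negP => d0.
  by have := xy (`|x - y| / 8); rewrite divr_gt0// => /(_ isT); lra.
exists mu; split.
- apply: close => e e0; have /filter_ex[B /= ] := muP setT e e0.
  by rewrite /weight preimage_setT l2_restrT u1 expr1n distrC; lra.
- move=> A; apply/ler_addgt0Pr => e e0.
  have /filter_ex[B /=] := muP A e e0; have /andP[+ _] := w01 B A.
  by rewrite ltr_norml => ? /andP[]; lra.
- move=> A C AC; apply: close => e e0.
  have /filter_ex[B [[/=]]] : U ([set B | `|weight (u B) A - mu A| < e] `&`
      [set B | `|weight (u B) C - mu C| < e] `&`
      [set B | `|weight (u B) (A `|` C) - mu (A `|` C)| < e]).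
    by apply: filterI; first apply: filterI; exact: muP.
  have -> : weight (u B) (A `|` C) = weight (u B) A + weight (u B) C.
    by apply: l2_norm_restrU; rewrite -preimage_setI AC preimage_set0.
  rewrite !ltr_norml ler_norml.
  by move=> /andP[? ?] /andP[? ?] /andP[? ?]; apply/andP; split; lra.
- move=> f A; apply: close => e e0.
  pose n := Num.Def.truncn e^-1.
  have ne : n.+1%:R^-1 <= e.
    by rewrite -[leRHS]invrK lef_pV2 ?posrE ?invr_gt0// ltW// truncnS_gt.
  pose fA := (fun x => (f * x)%g) @` A.
  have /filter_ex[B [[/= h1 h2] h3]] : U ([set B | `|weight (u B) A - mu A| < e] `&`
      [set B | `|weight (u B) fA - mu fA| < e] `&`
      [set B : {fset F * nat} | (f, n) \in B]).
    by apply: filterI; [apply: filterI; exact: muP|exact: Ux].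
  have [_ /(_ _ h3) /= un] := uP B.
  have := weight_translate A (u1 B) (le_trans un ne); rewrite -/fA.
  move: h1 h2; rewrite !ltr_norml !ler_norml.
  by move=> /andP[? ?] /andP[? ?] /andP[? ?]; apply/andP; split; lra.
Qed.

(** Otherwise almost invariant vectors would exist.  So finitely many [h f]
    suffice to move every unit vector by at least some [d > 0], and then the
    parallelogram law makes [u + u \o h f] shorter than [2 * l2_norm u] by a
    definite proportion for one of these [f]. *)
Lemma spectral_gap_of_nonamenable : ~ amenable R F ->
  exists (s : seq F) (c : R), [/\ 0 <= c, c < 1 & forall u : l2 R X,
    l2_norm (u + \sum_(f <- s) l2_comp (@hi f) u)
      <= c * (size s).+1%:R * l2_norm u].
Proof.
move=> nam.
have [B HB] : exists B : {fset F * nat}, forall u : l2 R X, l2_norm u = 1 ->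
    exists2 x, x \in B & x.2.+1%:R^-1 < l2_norm (l2_comp (@hi x.1) u - u).
  apply: contrapT => nB; apply: nam; apply: amenable_of_almost_invariant => B.
  apply: contrapT => nu; apply: nB; exists B => u u1; apply: contrapT => nx.
  apply: nu; exists u; split=> // x xB; rewrite leNgt; apply/negP => lt.
  by apply: nx; exists x.
pose s := [seq x.1 | x <- enum_fset B].
pose N := (\max_(x <- enum_fset B) x.2)%N.
pose d : R := N.+1%:R^-1.
have d0 : 0 < d by rewrite invr_gt0 ltr0n.
have d1 : d <= 1 by rewrite invf_le1 ?ler1n ?ltr0n.
(* chosen so that (2 - e) ^ 2 >= 4 - d ^ 2 *)
pose e := d ^+ 2 / 4.
have e0 : 0 < e by rewrite divr_gt0// exprn_gt0.
have e1 : e <= 1.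
  have : d ^+ 2 <= 1 by rewrite exprn_ile1// ltW.
  by rewrite /e => d2; lra.
pose m : R := (size s).+1%:R.
have m1 : 1 <= m by rewrite ler1n.
have m0 : 0 < m by lra.
exists s, (1 - e / m); split.
- rewrite subr_ge0 ler_pdivrMr//; lra.
- by rewrite ltrBlDr ltrDl divr_gt0.
move=> u; rewrite -/m.
have -> : (1 - e / m) * m = m - e by field; rewrite gt_eqF.
have [un0|un0] := eqVneq (l2_norm u) 0.
  rewrite un0 mulr0 (l2_norm0_eq0 un0) add0r big1 => [|f _].
    by rewrite -(scale0r 0) l2_normZ Normc.normc0 mul0r.
  by apply: l2_eq => x; rewrite -[LHS]/(val (0 : l2 R X) (h f x)) !l2_zeroE.
have u_gt0 : 0 < l2_norm u by rewrite lt0r un0 l2_norm_ge0.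
set n := l2_norm u in u_gt0 un0 *.
have [x xB xgap] : exists2 x, x \in B & d * n < l2_norm (l2_comp (@hi x.1) u - u).
  pose v := (n^-1)%:C *: u.
  have nc : Normc.normc (n^-1)%:C = n^-1 by rewrite /= expr0n addr0 sqrtr_sqr ger0_norm// invr_ge0 ltW.
  have [|x xB gap] := HB v; first by rewrite l2_normZ nc mulVf.
  exists x => //; have vE : l2_comp (@hi x.1) v - v = (n^-1)%:C *: (l2_comp (@hi x.1) u - u).
    by rewrite scalerBr; congr (_ - _); apply: l2_eq => y; rewrite -[LHS]/(val v (h x.1 y)) !l2_scaleE.
  move: gap; rewrite vE l2_normZ nc mulrC ltr_pdivlMr//; apply: le_lt_trans.
  rewrite ler_pM2r// lef_pV2 ?posrE ?ltr0n// ler_nat ltnS.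
  by rewrite /N (big_rem x)//= leq_maxl.
set w := l2_comp (@hi x.1) u.
have wn : l2_norm w = n by apply: l2_norm_comp (@kK _).
have uw : l2_norm (u + w) <= (2 - e) * n.
  have := l2_parallelogram u w; rewrite wn -/n -[u - w]opprB l2_normN => E.
  have dn : (d * n) ^+ 2 <= l2_norm (w - u) ^+ 2.
    by rewrite ler_pXn2r ?nnegrE ?mulr_ge0 ?l2_norm_ge0 ?ltW.
  have en : 0 <= (e * n) ^+ 2 := sqr_ge0 _.
  rewrite -(@ler_pXn2r _ 2)// ?nnegrE ?l2_norm_ge0//.
    have -> : ((2 - e) * n) ^+ 2 = 4 * n ^+ 2 - (d * n) ^+ 2 + (e * n) ^+ 2.
      by rewrite /e; field.
    lra.
  by rewrite mulr_ge0 ?ltW//; lra.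
have xs : x.1 \in s by apply/mapP; exists x.
rewrite (big_rem _ xs)/= addrA (le_trans (l2_normD _ _))//.
have S' : l2_norm (\sum_(y <- rem x.1 s) l2_comp (@hi y) u) <= (size (rem x.1 s))%:R * n.
  rewrite (le_trans (l2_norm_sum _ _))// (eq_bigr (fun=> n)) => [|y _].
    by rewrite big_const_seq count_predT iter_addr addr0 mulr_natl.
  exact: l2_norm_comp (@kK _).
have -> : m = (size (rem x.1 s))%:R + 2.
  rewrite /m (_ : (size s).+1 = size (rem x.1 s) + 2)%N ?natrD//.
  by rewrite size_rem// addn2 prednK//; case: (s) xs.
rewrite (le_trans (lerD uw S'))// le_eqVlt; apply/orP; left; apply/eqP; ring.
Qed.

End AlmostInvariant.

(** * Closed ideals and the operator norm *)

Section OperatorNorm.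
Variables (R : realType) (V : normedModType R[i]).
Implicit Types (a b : bop V) (S A J : set (bop V)).
Local Open Scope classical_set_scope.
Local Open Scope ring_scope.
Local Open Scope complex_scope.

Lemma op_norm_triangle a b : op_norm (a + b) <= op_norm a + op_norm b.
Proof. by rewrite -lecR rmorphD; exact: (ler_normD a b). Qed.

Lemma op_normM a b : op_norm (a * b) <= op_norm a * op_norm b.
Proof.
have [a0 ha] := op_normP a; have [b0 hb] := op_normP b.
apply: op_norm_le; split=> [|x]; first exact: mulr_ge0.
rewrite -[val (a * b) x]/(val a (val b x)) (le_trans (ha _))// rmorphM -mulrA.
by rewrite ler_wpM2l// ler0c.
Qed.

Lemma bop_scaleAl c a b : (c *: a) * b = c *: (a * b).
Proof. by apply: bop_eq => x; rewrite -[LHS]/(val (c *: a) (val b x)) !bop_scaleE. Qed.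

Lemma bop_linearZ a c x : val a (c *: x) = c *: val a x.
Proof.
have [la _] := bopP a; have a0 : val a 0 = 0.
  by have := la (-1) 0 0; rewrite scaler0 addr0 scaleN1r addNr.
by have := la c x 0; rewrite a0 !addr0.
Qed.

Lemma bop_scaleAr c a b : a * (c *: b) = c *: (a * b).
Proof.
by apply: bop_eq => x; rewrite -[LHS]/(val a (val (c *: b) x)) !bop_scaleE bop_linearZ.
Qed.

(** Closures in terms of the real-valued norm, so that estimates can be done
    in [R] instead of the partially ordered [R[i]]. *)
Lemma closure_op_normP S a :
  closure S a <-> forall e : R, 0 < e -> exists2 b, S b & op_norm (a - b) < e.
Proof.
split=> [cl e e0|cl B].
  have [|b [Sb /= ab]] := cl (ball a e%:C).
    by apply: nbhsx_ballx; rewrite ltcR.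
  by exists b => //; move: ab; rewrite -ball_normE /= -ltcR.
move=> /nbhs_ballP[e /= e0 eB].
have eE : e = (complex.Re e)%:C by rewrite RRe_real// gtr0_real.
have [|b Sb ab] := cl (complex.Re e); first by rewrite -ltcR -eE.
exists b; split=> //; apply: eB; rewrite -ball_normE /= eE.
by change (`|a - b|) with ((op_norm (a - b))%:C); rewrite ltcR.
Qed.

Lemma closed_op_normP S : closed S -> forall a,
  (forall e : R, 0 < e -> exists2 b, S b & op_norm (a - b) < e) -> S a.
Proof. by move=> cS a /closure_op_normP; exact: cS. Qed.

Lemma closure_ideal A J :
  J `<=` A -> J 0 -> (forall a b, J a -> J b -> J (a + b)) ->
  (forall c a, J a -> J (c *: a)) ->
  (forall a b, A a -> J b -> J (a * b)) ->
  (forall a b, A a -> J b -> J (b * a)) ->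
  closed_ideal (closure A) (closure J).
Proof.
move=> JA J0 JD JZ AJ JA'; split.
- exact: closure_subset.
- exact: closed_closure.
- exact: subset_closure.
- move=> a b /closure_op_normP ha /closure_op_normP hb.
  apply/closure_op_normP => e e0.
  have e2 : 0 < e / 2 by rewrite divr_gt0.
  have [x Jx ax] := ha _ e2; have [y Jy hy] := hb _ e2.
  exists (x + y); first exact: JD.
  by rewrite opprD addrACA (le_lt_trans (op_norm_triangle _ _))//; lra.
have prod a b : closure A a -> closure J b -> forall e : R, 0 < e ->
    exists x y, [/\ A x, J y, op_norm (a * b - x * y) < e &
      op_norm (b * a - y * x) < e].
  move=> /closure_op_normP ha /closure_op_normP hb e e0.
  have na := op_norm_ge0 a.
  have [|y Jy hy] := hb (e / 2 / (op_norm a + 1)).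
    by rewrite !divr_gt0//; lra.
  have ny := op_norm_ge0 y.
  have [|x Ax hx] := ha (e / 2 / (op_norm y + 1)).
    by rewrite !divr_gt0//; lra.
  rewrite ltr_pdivlMr in hx; last lra.
  rewrite ltr_pdivlMr in hy; last lra.
  have := op_norm_ge0 (a - x); have := op_norm_ge0 (b - y) => by0 ax0.
  exists x, y; split=> //.
    have -> : a * b - x * y = a * (b - y) + (a - x) * y.
      by rewrite mulrBr mulrBl addrA subrK.
    rewrite (le_lt_trans (op_norm_triangle _ _))//.
    by have := op_normM a (b - y); have := op_normM (a - x) y; nra.
  have -> : b * a - y * x = (b - y) * a + y * (a - x).
    by rewrite mulrBr mulrBl addrA subrK.
  rewrite (le_lt_trans (op_norm_triangle _ _))//.
  by have := op_normM (b - y) a; have := op_normM y (a - x); nra.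
split.
- move=> c a /closure_op_normP ha; apply/closure_op_normP => e e0.
  have c0 : 0 <= Normc.normc c by rewrite -ler0c -[_%:C]/(`|c|).
  have [|x Jx ax] := ha (e / (Normc.normc c + 1)); first by rewrite divr_gt0//; lra.
  exists (c *: x); first exact: JZ.
  rewrite -scalerBr (le_lt_trans (op_normZ_le _ _))//.
  rewrite ltr_pdivlMr in ax; last lra.
  by have := op_norm_ge0 (a - x); nra.
- move=> a b Aa Jb; apply/closure_op_normP => e e0.
  by have [x [y [Ax Jy h _]]] := prod a b Aa Jb e e0; exists (x * y) => //; exact: AJ.
- move=> a b Aa Jb; apply/closure_op_normP => e e0.
  by have [x [y [Ax Jy _ h]]] := prod a b Aa Jb e e0; exists (y * x) => //; exact: JA'.
Qed.

(** The Neumann series, read modulo [J]: [(1 - M ^+ k) * Y] lies in [J] for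
    every [k], and it tends to [Y]. *)
Lemma ideal_of_contraction A J M Y c : closed_ideal A J -> A M ->
  op_norm M <= c -> c < 1 -> J ((1 - M) * Y) -> J Y.
Proof.
move=> [_ Jc J0 JD [JZ AJ _]] AM Mc c1 JMY.
have c0 : 0 <= c := le_trans (op_norm_ge0 _) Mc.
have Jpow k : J ((1 - M ^+ k) * Y).
  elim: k => [|k IH]; first by rewrite subrr mul0r.
  have -> : (1 - M ^+ k.+1) * Y = (1 - M) * Y + M * ((1 - M ^+ k) * Y).
    by rewrite mulrA -mulrDl mulrBr mulr1 addrA subrK -exprS.
  by apply: JD => //; exact: AJ.
have Mpow k : op_norm (M ^+ k * Y) <= c ^+ k * op_norm Y.
  elim: k => [|k IH]; first by rewrite !expr0 !mul1r.
  rewrite exprS -mulrA (le_trans (op_normM _ _))// exprS -mulrA.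
  by rewrite ler_pM// op_norm_ge0.
apply: (closed_op_normP Jc) => e e0.
have : (fun k => c ^+ k * op_norm Y) @ \oo --> 0 * op_norm Y.
  by apply: cvgMr_tmp; apply: cvg_expr; rewrite ger0_norm.
rewrite mul0r => /cvgr0Pnorm_lt /(_ e e0) [k _ /(_ k (leqnn k)) /= ck].
exists ((1 - M ^+ k) * Y) => //.
rewrite mulrBl mul1r opprB addrC subrK (le_lt_trans (Mpow k))//.
by rewrite (le_lt_trans (ler_norm _)).
Qed.

End OperatorNorm.

(** * The group algebra and the kernel of pi *)

Section RepresentationSums.
Variables (R : realType) (G : groupType) (V : normedModType R[i]).
Variable rho : G -> bop V.
Hypothesis rhoM : forall g h, rho (g * h)%g = (rho g * rho h)%R.
Local Open Scope ring_scope.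

(** An element of the group algebra is written as a list of weighted group
    elements, repetitions allowed: concatenation and pairwise products of lists
    model its operations, and the same list is evaluated in both lambda and
    pi. *)
Definition rep_sum (s : seq (R[i] * G)) : bop V := \sum_(x <- s) x.1 *: rho x.2.

Definition formal_scale (c : R[i]) (s : seq (R[i] * G)) : seq (R[i] * G) :=
  [seq (c * x.1, x.2) | x <- s].

Definition formal_mul (s t : seq (R[i] * G)) : seq (R[i] * G) :=
  [seq (x.1 * y.1, (x.2 * y.2)%g) | x <- s, y <- t].

Lemma rep_sum_nil : rep_sum [::] = 0. Proof. exact: big_nil. Qed.

Lemma rep_sum_cat s t : rep_sum (s ++ t) = rep_sum s + rep_sum t.
Proof. exact: big_cat. Qed.

Lemma rep_sum_scale c s : rep_sum (formal_scale c s) = c *: rep_sum s.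
Proof.
rewrite /rep_sum big_map scaler_sumr; apply: eq_bigr => x _.
by rewrite scalerA.
Qed.

Lemma rep_sum_mul s t : rep_sum (formal_mul s t) = rep_sum s * rep_sum t.
Proof.
rewrite /rep_sum big_allpairs_dep mulr_suml; apply: eq_bigr => x _.
rewrite mulr_sumr; apply: eq_bigr => y _.
by rewrite /= rhoM bop_scaleAl bop_scaleAr scalerA.
Qed.

Lemma rep_sum1 (g : G) : rep_sum [:: (1, g)] = rho g.
Proof. by rewrite /rep_sum big_seq1 scale1r. Qed.

Lemma rep_sum_set (s : seq G) : rep_sum [seq (1, g) | g <- s] = \sum_(g <- s) rho g.
Proof. by rewrite /rep_sum big_map; apply: eq_bigr => g _; rewrite scale1r. Qed.

End RepresentationSums.

Section Kernel.
Variable R : realType.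
Local Notation T := (thompsonT R).
Local Notation lam := (@lambda_rep R).
Local Notation pir := (@pi_rep R).
Local Open Scope classical_set_scope.
Local Open Scope ring_scope.

Lemma lambda_rep1 : lam 1%g = 1.
Proof.
by apply: bop_eq => u; apply: l2_eq => t; rewrite /= invg1 mul1g.
Qed.

Lemma lambda_repM g h : lam (g * h)%g = lam g * lam h.
Proof.
by apply: bop_eq => u; apply: l2_eq => t; rewrite /= invgM mulgA.
Qed.

Lemma pi_rep1 : pir 1%g = 1.
Proof.
by apply: bop_eq => u; apply: l2_eq => t; rewrite /= invg1 dyadic_act1.
Qed.

Lemma pi_repM g h : pir (g * h)%g = pir g * pir h.
Proof.
by apply: bop_eq => u; apply: l2_eq => t; rewrite /= invgM dyadic_actM.
Qed.

Lemma lambda_group_algebraP a :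
  lambda_group_algebra R a <-> exists s, a = rep_sum lam s.
Proof.
split=> [[s [c ->]]|[s ->]].
  by exists [seq (c g, g) | g <- s]; rewrite /rep_sum big_map.
pose t := undup [seq x.2 | x <- s].
exists t, (fun g => \sum_(x <- s | x.2 == g) x.1).
rewrite /rep_sum [LHS](eq_big_seq (fun x => \sum_(g <- t | g == x.2) x.1 *: lam g)).
  rewrite (exchange_big_dep predT)//=; apply: eq_bigr => g _.
  by rewrite scaler_suml; apply: eq_bigl => x; rewrite eq_sym.
move=> x xs; rewrite -big_filter filter_pred1_uniq ?undup_uniq ?big_seq1//.
by rewrite mem_undup; apply/mapP; exists x.
Qed.

(** The image under lambda of the kernel of pi on the group algebra; the list
    [s] stands for an element of the group algebra above [a]. *)
Definition pi_kernel : set (bop (l2 R T)) :=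
  [set a | exists2 s, a = rep_sum lam s & rep_sum pir s = 0].

Lemma pi_kernel_ideal : closed_ideal (Cstar_red R) (closure pi_kernel).
Proof.
apply: closure_ideal.
- by move=> a [s -> _]; apply/lambda_group_algebraP; exists s.
- by exists [::]; rewrite rep_sum_nil.
- move=> _ _ [s -> s0] [t -> t0]; exists (s ++ t); first by rewrite rep_sum_cat.
  by rewrite rep_sum_cat s0 t0 addr0.
- move=> c _ [s -> s0]; exists (formal_scale c s); first by rewrite rep_sum_scale.
  by rewrite rep_sum_scale s0 scaler0.
- move=> _ _ /lambda_group_algebraP[t ->] [s -> s0]; exists (formal_mul t s).
    by rewrite rep_sum_mul//; exact: lambda_repM.
  by rewrite rep_sum_mul ?s0 ?mulr0//; exact: pi_repM.
- move=> _ _ /lambda_group_algebraP[t ->] [s -> s0]; exists (formal_mul s t).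
    by rewrite rep_sum_mul//; exact: lambda_repM.
  by rewrite rep_sum_mul ?s0 ?mul0r//; exact: pi_repM.
Qed.

Lemma Cstar_red_ideal : closed_ideal (Cstar_red R) (Cstar_red R).
Proof.
apply: closure_ideal => //.
- by apply/lambda_group_algebraP; exists [::]; rewrite rep_sum_nil.
- move=> _ _ /lambda_group_algebraP[s ->] /lambda_group_algebraP[t ->].
  by apply/lambda_group_algebraP; exists (s ++ t); rewrite rep_sum_cat.
- move=> c _ /lambda_group_algebraP[s ->].
  by apply/lambda_group_algebraP; exists (formal_scale c s); rewrite rep_sum_scale.
- move=> _ _ /lambda_group_algebraP[t ->] /lambda_group_algebraP[s ->].
  apply/lambda_group_algebraP; exists (formal_mul t s).
  by rewrite rep_sum_mul//; exact: lambda_repM.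
- move=> _ _ /lambda_group_algebraP[t ->] /lambda_group_algebraP[s ->].
  apply/lambda_group_algebraP; exists (formal_mul s t).
  by rewrite rep_sum_mul//; exact: lambda_repM.
Qed.

Lemma Cstar_red_rep_sum s : Cstar_red R (rep_sum lam s).
Proof. by apply: subset_closure; apply/lambda_group_algebraP; exists s. Qed.

Lemma Cstar_red_lambda g : Cstar_red R (lam g).
Proof. by rewrite -(rep_sum1 lam); exact: Cstar_red_rep_sum. Qed.

End Kernel.

(** * Indicator vectors of finite sets *)

Section Indicators.
Variables (R : realType) (X : choiceType).
Implicit Types (A B : {fset X}).
Local Open Scope fset_scope.
Local Open Scope ring_scope.

Definition l2_ind A : l2 R X := \sum_(x <- A) l2_delta R x.

Lemma l2_sumE (I : Type) (s : seq I) (F : I -> l2 R X) x :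
  val (\sum_(i <- s) F i) x = \sum_(i <- s) val (F i) x.
Proof.
elim: s => [|i s IH]; first by rewrite !big_nil l2_zeroE.
by rewrite !big_cons l2_addE IH.
Qed.

Lemma l2_indE A x : val (l2_ind A) x = (x \in A)%:R.
Proof.
rewrite l2_sumE /= (eq_bigr (fun y => if y == x then 1 else 0)) => [|y _]; last first.
  by rewrite eq_sym; case: eqP.
rewrite -big_mkcond/= big_const_seq -size_filter.
have -> : [seq y <- A | y == x] = if x \in A then [:: x] else [::].
  case: ifP => xA; first by rewrite filter_pred1_uniq.
  by apply/eqP; rewrite -size_eq0 size_filter -leqn0 leqNgt -has_count has_pred1 xA.
by case: ifP => _ /=; rewrite ?addr0.
Qed.

Lemma l2_norm_ind A : l2_norm (l2_ind A) ^+ 2 = #|` A|%:R.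
Proof.
apply: EFin_inj; rewrite -l2_sqnormE.
have -> : val (l2_ind A) = fun x => if x \in [set` A]%classic then 1 else 0.
  by apply/funext => x; rewrite l2_indE mem_setE; case: (x \in A).
rewrite (@l2_sqnorm_restr _ _ _ (fun=> 1)) esum_fset//; last first.
  by move=> x _; rewrite lee_fin sqr_ge0.
rewrite fsbig_finite//= set_fsetK.
rewrite sumEFin; congr (_%:E).
rewrite (eq_bigr (fun=> 1)) => [|x _]; last first.
  by rewrite expr0n addr0 expr1n sqrtr1 expr1n.
by rewrite big_const_seq count_predT iter_addr addr0 -mulr_natl mulr1.
Qed.

Lemma l2_indB A B : l2_ind A - l2_ind B = l2_ind (A `\` B) - l2_ind (B `\` A).
Proof.
apply: l2_eq => x; rewrite !l2_addE !l2_oppE !l2_indE !in_fsetD.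
by case: (x \in A); case: (x \in B); rewrite /= ?subrr ?subr0 ?sub0r.
Qed.

End Indicators.

(** * For F with Folner sets the kernel of pi stays away from 1 *)

Section WeakContainment.
Variable R : realType.
Local Notation T := (thompsonT R).
Local Notation F := (thompsonF R).
Local Notation lam := (@lambda_rep R).
Local Notation pir := (@pi_rep R).
Local Open Scope classical_set_scope.
Local Open Scope ring_scope.
Local Open Scope complex_scope.

Lemma bop_sumE (V : normedModType R[i]) (I : Type) (s : seq I) (P : pred I)
    (f : I -> bop V) x :
  val (\sum_(i <- s | P i) f i) x = \sum_(i <- s | P i) val (f i) x.
Proof.
elim: s => [|i s IH]; first by rewrite !big_nil raddf0.
by rewrite !big_cons; case: ifP => _; rewrite ?bop_addE IH.
Qed.

Lemma rep_sumE (G : groupType) (V : normedModType R[i]) (rho : G -> bop V) s x :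
  val (rep_sum rho s) x = \sum_(y <- s) y.1 *: val (rho y.2) x.
Proof. by rewrite bop_sumE; apply: eq_bigr => y _; rewrite bop_scaleE. Qed.

Lemma dyadic0 : circle_pt 0 \in dyadic R.
Proof. by rewrite inE; exists 0 => //; exists 0%N => //; rewrite mul0r. Qed.

Definition origin : dyadic R := exist _ (circle_pt 0) dyadic0.

(** The coefficient at the origin of the image of the basis vector there: the
    terms that contribute are those of [F]. *)
Lemma pi_kernel_fixes0_sum s : rep_sum pir s = 0 ->
  \sum_(x <- s | fixes0 x.2) x.1 = 0.
Proof.
move=> s0; have := rep_sumE pir s (l2_delta R origin).
rewrite s0 raddf0 => /(congr1 (fun u : l2 R (dyadic R) => val u origin)).
rewrite l2_zeroE l2_sumE => E; rewrite big_mkcond; apply: etrans (esym E).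
apply: eq_bigr => x _.
rewrite l2_scaleE pi_rep_delta /= -val_eqE /= eq_sym.
by case: ifP => h; rewrite [_ == _]h ?mulr1 ?mulr0.
Qed.

Lemma lambda_rep_ind g (A : {fset T}) :
  val (lam g) (l2_ind R A) = l2_ind R [fset (g * t)%g | t in A]%fset.
Proof.
apply: l2_eq => x; rewrite -[LHS]/(val (l2_ind R A) (g^-1 * x)%g) !l2_indE.
congr (_%:R); congr nat_of_bool; apply/idP/imfsetP => [xA|[t /= tA ->]].
  by exists (g^-1 * x)%g; rewrite // mulVKg.
by rewrite mulKg.
Qed.

Lemma lambda_rep_ind_close g (A : {fset T}) (e : R) : 0 <= e ->
  #|` [fset (g * t)%g | t in A] `\` A|%fset%:R <= e ^+ 2 * #|` A|%fset%:R ->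
  l2_norm (val (lam g) (l2_ind R A) - l2_ind R A) <= 2 * e * l2_norm (l2_ind R A).
Proof.
move=> e0; rewrite lambda_rep_ind; set gA := [fset _ | t in A]%fset => h.
have cgA : (#|` gA| = #|` A|)%fset.
  by rewrite card_imfset//; exact: mulgI.
have h' : #|` A `\` gA|%fset%:R <= e ^+ 2 * #|` A|%fset%:R.
  suff -> : (#|` A `\` gA| = #|` gA `\` A|)%fset by [].
  by rewrite !cardfsD cgA fsetIC.
have half (B : {fset T}) : #|` B|%fset%:R <= e ^+ 2 * #|` A|%fset%:R ->
    l2_norm (l2_ind R B) <= e * l2_norm (l2_ind R A).
  rewrite -!l2_norm_ind -exprMn ler_pXn2r// nnegrE ?mulr_ge0 ?l2_norm_ge0//.
rewrite l2_indB (le_trans (l2_normD _ _))// l2_normN.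
by have := half _ h; have := half _ h'; lra.
Qed.

(** Let [u] be the indicator of a Folner set of [F], seen in [T].  Restricting
    [(1 - rep_sum lam s) u] to the subset [F] of [T] kills the terms of [s]
    outside [F]; the others nearly fix [u], and their coefficients add up to
    [0], so what is left is close to [u]. *)
Lemma folner_kernel_far s : folner R F -> rep_sum pir s = 0 ->
  2^-1 <= op_norm (1 - rep_sum lam s).
Proof.
move=> fol s0.
pose C : R := 1 + \sum_(x <- s) Normc.normc x.1.
have nc0 (c : R[i]) : 0 <= Normc.normc c by rewrite -ler0c -[_%:C]/(`|c|).
have C1 : 1 <= C by rewrite lerDl sumr_ge0.
(* each term moves u by at most 2 * e, so all together by 2 * e * C = 1 / 2 *)
pose e := (4 * C)^-1.
have C0 : 0 < C by lra.
have e0 : 0 < e by rewrite invr_gt0; lra.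
have eC : 4 * e * C = 1 by rewrite /e; field; rewrite gt_eqF.
pose S : {fset F} := [fset f in pmap insub [seq x.2 | x <- s]]%fset.
have [A A0 SA] := fol S (e ^+ 2) (exprn_gt0 _ e0).
pose B : {fset T} := [fset val t | t in A]%fset.
pose u := l2_ind R B.
have u_gt0 : 0 < l2_norm u.
  rewrite lt0r l2_norm_ge0 andbT -sqrf_eq0 l2_norm_ind.
  rewrite pnatr_eq0 cardfs_eq0; case/fset0Pn: A0 => t tA.
  by apply/fset0Pn; exists (val t); apply/imfsetP; exists t.
have close x : x \in s -> fixes0 x.2 ->
    l2_norm (val (lam x.2) u - u) <= 2 * e * l2_norm u.
  move=> xs xF; apply: lambda_rep_ind_close; first exact: ltW.
  pose f : F := Sub x.2 xF.
  have fS : f \in S.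
    by rewrite !inE /= mem_pmap_sub; apply/mapP; exists x.
  have cB : #|` B|%fset = #|` A|%fset by rewrite card_imfset//; exact: val_inj.
  rewrite cB; apply: le_trans (SA f fS); rewrite ler_nat.
  apply: (@leq_trans #|` [fset val t | t in [fset (f * t)%g | t in A] `\` A]|%fset).
    apply: fsubset_leq_card; apply/fsubsetP => y.
    rewrite in_fsetD => /andP[yB /imfsetP[z /= /imfsetP[t /= tA ->] yE]].
    have yf : y = val (f * t)%g by rewrite yE.
    apply/imfsetP; exists (f * t)%g => //=; rewrite in_fsetD; apply/andP; split.
      by apply: contra yB => ft; rewrite yf; apply/imfsetP; exists (f * t)%g.
    by apply/imfsetP; exists t.
  exact: leq_imfset_card.
pose VF := [set g : T | fixes0 g].
pose err : l2 R T := \sum_(x <- s | fixes0 x.2) x.1 *: (val (lam x.2) u - u).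
have uF : l2_restr VF u = u.
  apply: l2_eq => t; rewrite l2_restrE; case: ifPn => //; rewrite notin_setE => tF.
  rewrite l2_indE; case: (boolP (t \in B)) => // /imfsetP[f /= fA tf].
  by case: tF; rewrite tf /VF /=; exact: (valP f).
have restr_lam g : l2_restr VF (val (lam g) u) =
    if fixes0 g then val (lam g) u else 0.
  have gt t : t \in B -> fixes0 (g * t)%g = fixes0 g.
    move=> /imfsetP[f /= fA ->].
    have := valP f; rewrite /fixes0 /= => /eqP ->.
    by [].
  apply: l2_eq => t; rewrite l2_restrE /u lambda_rep_ind.
  case: (boolP (t \in [fset (g * t)%g | t in B]%fset)) => tgB; last first.
    have E : val (l2_ind R [fset (g * t)%g | t in B]%fset) t = 0.
      by rewrite l2_indE (negbTE tgB).
    by case: ifP => _; case: ifP => _; rewrite ?l2_zeroE ?E.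
  have <- : (t \in VF) = fixes0 g.
    by case/imfsetP: tgB => t' /= /gt <- ->; apply/idP/idP; rewrite inE.
  by case: ifP => _; rewrite ?l2_zeroE.
have key : l2_restr VF (val (1 - rep_sum lam s) u) =
    u - err.
  have -> : val (1 - rep_sum lam s) u = u - val (rep_sum lam s) u.
    by rewrite bop_addE raddfN.
  rewrite l2_restrB uF; congr (_ - _); rewrite rep_sumE /err.
  under [RHS]eq_bigr => x _ do rewrite scalerBr.
  rewrite sumrB -scaler_suml (pi_kernel_fixes0_sum s0) scale0r subr0.
  rewrite [RHS]big_mkcond; apply: l2_eq => t; rewrite l2_restrE !l2_sumE.
  have E x : (if t \in VF then val (x.1 *: val (lam x.2) u) t else 0) =
      val (if fixes0 x.2 then x.1 *: val (lam x.2) u else 0) t.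
    have := congr1 (fun v : l2 R T => val v t) (restr_lam x.2).
    rewrite l2_restrE; case: ifP => _; case: ifP => _ h //.
    - by rewrite l2_scaleE h !l2_zeroE mulr0.
    - by rewrite l2_scaleE -h mulr0.
  case: (boolP (t \in VF)) E => _ E; first by apply: eq_bigr => x _; exact: E.
  by rewrite big1// => x _; rewrite -E.
have low : l2_norm u / 2 <= l2_norm (val (1 - rep_sum lam s) u).
  apply: le_trans (l2_norm_restr_le VF _); rewrite key.
  have N : l2_norm err <= 2 * e * C * l2_norm u.
    rewrite /err -big_filter (le_trans (l2_norm_sum _ _))//.
    rewrite (@le_trans _ _ (\sum_(x <- s | fixes0 x.2)
        Normc.normc x.1 * (2 * e * l2_norm u)))//.
      rewrite big_filter big_seq_cond [leRHS]big_seq_cond; apply: ler_sum => x /andP[xs xF].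
      by rewrite l2_normZ ler_wpM2l ?close.
    rewrite -mulr_suml [leRHS](_ : _ = C * (2 * e * l2_norm u)); last by ring.
    apply: ler_wpM2r; first by rewrite !mulr_ge0 ?l2_norm_ge0 ?ltW.
    rewrite big_mkcond /C -[leLHS]add0r lerD//; apply: ler_sum => x _.
    by case: ifP.
  have := l2_normD (u - err) err.
  have eC2 : 2 * e * C = 2^-1 by lra.
  by rewrite subrK; rewrite eC2 in N; lra.
have [_ /(_ u)] := op_normP (1 - rep_sum lam s).
change (`|val (1 - rep_sum lam s) u|) with ((l2_norm (val (1 - rep_sum lam s) u))%:C).
change (`|u|) with ((l2_norm u)%:C); rewrite -rmorphM lecR => hi.
by rewrite -(ler_pM2r u_gt0) (le_trans _ hi)// mulrC.
Qed.

Lemma pi_kernel_proper : folner R F -> ~ closure (@pi_kernel R) 1.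
Proof.
move=> fol /closure_op_normP /(_ 2^-1) [|_ [s -> s0]]; first by rewrite invr_gt0.
by rewrite ltNge folner_kernel_far.
Qed.

End WeakContainment.

(** * Propagating through an ideal when F is not amenable *)

Section RingIdentities.
Variable A : pzRingType.
Implicit Types g h i j y : A.
Local Open Scope ring_scope.

Lemma subr1M_mul g h y : (1 - g * h) * y = (1 - g) * y + g * ((1 - h) * y).
Proof. by rewrite mulrA -mulrDl mulrBr mulr1 addrA subrK. Qed.

Lemma subr1_inv g j y : j * g = 1 -> (1 - j) * y = - (j * ((1 - g) * y)).
Proof. by move=> jg; rewrite mulrA -mulNr mulrBr jg mulr1 opprB. Qed.

Lemma subr1_conj i g j y : i * j = 1 -> y * j = j * y ->
  (1 - i * g * j) * y = i * ((1 - g) * y) * j.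
Proof.
move=> ij yj; rewrite -[RHS]mulrA -[_ * y * j]mulrA yj !mulrA; congr (_ * _).
by rewrite mulrBr mulr1 mulrBl ij.
Qed.

End RingIdentities.

Section Propagation.
Variable R : realType.
Local Notation T := (thompsonT R).
Local Notation F := (thompsonF R).
Local Notation lam := (@lambda_rep R).
Local Open Scope classical_set_scope.
Local Open Scope ring_scope.
Local Open Scope complex_scope.

Lemma thompsonTK (g : T) : cancel (val g) (val g^-1%g).
Proof. by move=> x; have /(congr1 (fun k : T => val k x)) := mulVg g. Qed.

Lemma thompsonTKV (g : T) : cancel (val g^-1%g) (val g).
Proof. by move=> x; have /(congr1 (fun k : T => val k x)) := mulgV g. Qed.

Variables (iota : F -> T) (I : set (circle R)).
Hypothesis iotaM : forall f g, iota (f * g)%g = (iota f * iota g)%g.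
Hypothesis iota_inj : injective iota.
Hypothesis iota_supp : forall f x, ~ I x -> val (iota f) x = x.

Let iota1 : iota 1%g = 1%g.
Proof. by apply: (@mulgI _ (iota 1%g)); rewrite -iotaM !mulg1. Qed.

Let iotaV f : iota f^-1%g = (iota f)^-1%g.
Proof. by apply: (@mulgI _ (iota f)); rewrite -iotaM !mulgV iota1. Qed.

Let iota_stable f x : I x -> I (val (iota f) x).
Proof.
move=> Ix; apply: contrapT => nI; apply: (nI); have := iota_supp f nI.
by move/(can_inj (thompsonTK _)) => ->.
Qed.

Let acts_as (e : T) (f : F) : Prop := forall x, I x -> val e x = val (iota f) x.

Let acts_asM e f e' f' : acts_as e f -> acts_as e' f' -> acts_as (e * e')%g (f * f')%g.
Proof.
move=> ef ef' x Ix; rewrite -[LHS]/(val e (val e' x)) ef' // ef; last exact: iota_stable.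
by rewrite iotaM.
Qed.

Let acts_asV e f : acts_as e f -> acts_as e^-1%g f^-1%g.
Proof.
move=> ef x Ix; apply: (can_inj (thompsonTK e)); rewrite thompsonTKV ef.
  by rewrite iotaV thompsonTKV.
exact: iota_stable.
Qed.

Let acts_as_inj e f f' : acts_as e f -> acts_as e f' -> f = f'.
Proof.
move=> ef ef'; apply: iota_inj; apply: thompsonT_eq => x.
have [Ix|nI] := pselect (I x); first by rewrite -ef// ef'.
by rewrite !iota_supp.
Qed.

(** The elements of [T] that act on [I] like some [iota f] form a subgroup that
    maps onto [F], by [e |-> f].  The value of [p] at [t] is the image of
    [t * r^-1], where [r] is a chosen representative of the coset of [t] for
    this subgroup. *)
Lemma equivariant_retract : exists p : T -> F, forall (e : T) (f : F) (t : T),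
  (forall x, I x -> val e x = val (iota f) x) -> p (e * t)%g = (f * p t)%g.
Proof.
pose C (t : T) : set T := [set r | exists f, acts_as (t * r^-1)%g f].
pose rep t := xget 1%g (C t).
have repP t : exists f, acts_as (t * (rep t)^-1)%g f.
  have : C t (rep t).
    apply: (@xgetPex _ 1%g (C t)); exists t, 1%g => x Ix.
    by rewrite iota1 mulgV.
  by [].
have /choice[p pP] := repP.
exists p => e f t ef.
have CE : C (e * t)%g = C t.
  apply/seteqP; split=> r [f' Hf'].
    exists (f^-1 * f')%g; have := acts_asM (acts_asV ef) Hf'.
    by rewrite -!mulgA mulKg.
  by exists (f * f')%g; rewrite -mulgA; exact: acts_asM.
apply: acts_as_inj (pP _) _; rewrite /rep CE -mulgA; exact: acts_asM.
Qed.

Variable a : T.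
Hypothesis aI : forall x, I x -> ~ I (val a x).

(** As [a] moves [I] off itself, [z f] acts on [I] like [iota f]: its other
    factor acts like [iota f^-1], but on [a I].  Being a commutator with [a],
    [z f] belongs to the normal subgroup generated by [a]. *)
Let z f : T := (a * iota f^-1 * a^-1 * iota f)%g.

Let z_acts f : acts_as (z f) f.
Proof.
move=> x Ix; rewrite -[LHS]/(val a (val (iota f^-1%g) (val a^-1%g (val (iota f) x)))).
rewrite iota_supp ?thompsonTKV// => /aI; rewrite thompsonTKV; apply.
exact: iota_stable.
Qed.

(** The spectral gap of [F] is inherited by the elements [z f], although these
    do not multiply like the elements of [F]. *)
Lemma commutator_gap : ~ amenable R F -> exists (s : seq F) (M : bop (l2 R T)) c,
  [/\ op_norm M <= c, c < 1 &
      ((size s).+1%:R : R[i]) *: (1 - M) = \sum_(f <- s) (1 - lam (z f)^-1%g)].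
Proof.
move=> nam; have [p pE] := equivariant_retract.
pose h f t := (z f * t)%g; pose k f t := ((z f)^-1 * t)%g.
have hK f : cancel (h f) (k f) by move=> t; rewrite /h /k mulKg.
have kK f : cancel (k f) (h f) by move=> t; rewrite /h /k mulVKg.
have phE f t : p (h f t) = (f * p t)%g by apply: pE; exact: z_acts.
have [s [c [c0 c1 gap]]] := spectral_gap_of_nonamenable hK kK phE nam.
pose m : R := (size s).+1%:R.
have m0 : 0 < m by rewrite ltr0n.
pose N : bop (l2 R T) := 1 + \sum_(f <- s) lam (z f)^-1%g.
have NE u : val N u = u + \sum_(f <- s) l2_comp (can_inj (hK f)) u.
  rewrite bop_addE bop_sumE; congr (_ + _); apply: eq_bigr => f _.
  by apply: l2_eq => t /=; rewrite invgK.
have mC : (size s).+1%:R = m%:C :> R[i] by rewrite /m rmorph_nat.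
exists s, (m^-1%:C *: N), c; split=> //.
  have nc : Normc.normc m^-1%:C = m^-1.
    by rewrite /= expr0n addr0 sqrtr_sqr ger0_norm// invr_ge0 ltW.
  rewrite (le_trans (op_normZ_le _ _))// nc mulrC ler_pdivrMr//.
  apply: op_norm_le; split=> [|u]; first by rewrite mulr_ge0// ltW.
  rewrite NE; change (`|u|) with ((l2_norm u)%:C).
  rewrite -[leLHS]/((l2_norm (u + \sum_(f <- s) l2_comp (can_inj (hK f)) u))%:C).
  by rewrite -rmorphM lecR gap.
rewrite scalerBr scalerA mC -rmorphM divff ?gt_eqF// rmorph1 scale1r.
rewrite sumrB big_const_seq count_predT iter_addr addr0 /N opprD addrA; congr (_ - _).
by rewrite -mC scaler_nat mulrS addrAC subrr add0r.
Qed.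

(** The [g] with [(1 - lam g) * Y] in [J] form a subgroup that is stable under
    conjugation by the [iota f], as these commute with [Y]; hence it contains
    [a] and all the [z f].  Averaging over the [z f] of the spectral gap
    produces [(1 - M) * Y] in [J] with a contraction [M]. *)
Lemma ideal_propagation J Y : ~ amenable R F -> closed_ideal (Cstar_red R) J ->
  (forall f, Y * lam (iota f) = lam (iota f) * Y) ->
  J ((1 - lam a) * Y) -> J Y.
Proof.
move=> nam Jid YC Ja; have [_ _ J0 JD [JZ AJ JA]] := Jid.
pose N (g : T) : Prop := J ((1 - lam g) * Y).
have NM g g' : N g -> N g' -> N (g * g')%g.
  move=> Ng Ng'; rewrite /N.
  rewrite lambda_repM subr1M_mul.
  by apply: JD => //; apply: AJ => //; exact: Cstar_red_lambda.
have NV g : N g -> N g^-1%g.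
  move=> Ng; rewrite /N.
  rewrite (subr1_inv (g := lam g)); last by rewrite -lambda_repM mulVg lambda_rep1.
  rewrite -scaleN1r.
  by apply: JZ; apply: AJ => //; exact: Cstar_red_lambda.
have NJ g f : N g -> N (iota f * g * iota f^-1)%g.
  move=> Ng; rewrite /N.
  rewrite !lambda_repM subr1_conj//; last first.
    by rewrite -lambda_repM iotaV mulgV lambda_rep1.
  by apply: JA; [exact: Cstar_red_lambda|apply: AJ => //; exact: Cstar_red_lambda].
have Nz f : N (z f).
  have -> : z f = (a * (iota f^-1 * a^-1 * iota f))%g by rewrite /z !mulgA.
  apply: NM => //; rewrite -[in iota f](invgK f); apply: NJ; exact: NV.
have [s [M [c [Mc c1 ME]]]] := commutator_gap nam.
pose mm : R[i] := (size s).+1%:R.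
have mm0 : mm != 0 by rewrite pnatr_eq0.
have sumN : J ((\sum_(f <- s) (1 - lam (z f)^-1%g)) * Y).
  rewrite mulr_suml; elim: (s) => [|f s' IH]; first by rewrite big_nil.
  by rewrite big_cons; apply: JD => //; exact: NV.
apply: (@ideal_of_contraction _ _ _ J M Y c Jid) => //; last first.
  rewrite -(scalerK mm0 (1 - M)) ME bop_scaleAl; exact: JZ.
(* [M] is [1] minus the average of the [1 - lam (z f)^-1], written as a list *)
have -> : M = rep_sum lam ((1, 1%g) :: formal_scale (- mm^-1)
    (\big[cat/[::]]_(f <- s) [:: (1, 1%g); (-1, (z f)^-1%g)])).
  rewrite /rep_sum big_cons scale1r lambda_rep1.
  rewrite -/(rep_sum _ _) rep_sum_scale scaleNr.
  rewrite -[LHS](subKr 1); congr (1 - _); rewrite -[LHS](scalerK mm0) ME; congr (_ *: _).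
  elim: (s) => [|f s' IH]; first by rewrite !big_nil rep_sum_nil.
  rewrite !big_cons rep_sum_cat -IH; congr (_ + _).
  by rewrite /rep_sum !big_cons big_nil addr0 scale1r scaleN1r lambda_rep1.
exact: Cstar_red_rep_sum.
Qed.

End Propagation.

(** * Dyadic piecewise-linear maps of the unit interval *)

Section UnitInterval.
Variable R : realType.
Local Notation T := (thompsonT R).
Local Notation F := (thompsonF R).
Local Notation pt := (@circle_pt R).
Local Notation dy := (fun x : R => dyadic R (circle_pt x)).
Implicit Types (phi psi : R -> R) (x y t u : R).
Local Open Scope classical_set_scope.
Local Open Scope ring_scope.

Lemma unit_decomposition x : exists (m : int) t, 0 <= t < 1 /\ x = t + m%:~R.
Proof.
exists (Num.floor x), (x - (Num.floor x)%:~R); have := floor_itv x.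
by rewrite intrD => /andP[? ?]; split; [apply/andP; split|]; lra.
Qed.

Lemma unit_decomposition_unique t u (m n : int) : 0 <= t < 1 -> 0 <= u < 1 ->
  t + m%:~R = u + n%:~R -> m = n /\ t = u.
Proof.
move=> /andP[t0 t1] /andP[u0 u1] E.
have mn : m = n.
  apply/eqP; rewrite eq_le -!ltzD1 -!(ltr_int R) !intrD.
  by apply/andP; split; lra.
by split=> //; move: E; rewrite mn => /addIr.
Qed.

Lemma circle_pt_unit p : exists2 t, 0 <= t < 1 & pt t = p.
Proof.
have [x <-] := circle_pt_surj p; have [m [t [t01 ->]]] := unit_decomposition x.
by exists t => //; apply/esym/circle_ptP; exists m.
Qed.

Lemma circle_pt_unit_inj t u : 0 <= t < 1 -> 0 <= u < 1 -> pt t = pt u -> t = u.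
Proof.
move=> t01 u01 /circle_ptP[m E].
have E' : t + 0%:~R = u + m%:~R by rewrite addr0.
by have [_ ->] := unit_decomposition_unique t01 u01 E'.
Qed.

Lemma circle_pt_int x (m : int) : pt (x + m%:~R) = pt x.
Proof. by apply/circle_ptP; exists m. Qed.

Lemma dyadicE x : dy x <-> exists (m : int) (n : nat), x = m%:~R / 2 ^+ n.
Proof.
split=> [[m _ [n _ /esym/circle_ptP[k ->]]]|[m [n ->]]]; last by exists m => //; exists n.
exists (m + k * 2 ^+ n), n.
by rewrite intrD intrM mulrDl rmorphXn/= mulfK// expf_eq0 pnatr_eq0 andbF.
Qed.

Lemma dyadicD x y : dy x -> dy y -> dy (x + y).
Proof.
move=> /dyadicE[m [n ->]] /dyadicE[m' [n' ->]]; apply/dyadicE.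
exists (m * 2 ^+ n' + m' * 2 ^+ n), (n + n')%N.
have n0 k : 2 ^+ k != 0 :> R by rewrite expf_eq0 pnatr_eq0 andbF.
by rewrite intrD !intrM !rmorphXn/= exprD; field; rewrite !n0.
Qed.

Lemma dyadicN x : dy x -> dy (- x).
Proof.
by move=> /dyadicE[m [n ->]]; apply/dyadicE; exists (- m), n; rewrite intrN mulNr.
Qed.

Lemma dyadicM x y : dy x -> dy y -> dy (x * y).
Proof.
move=> /dyadicE[m [n ->]] /dyadicE[m' [n' ->]]; apply/dyadicE.
exists (m * m'), (n + n')%N.
have n0 k : 2 ^+ k != 0 :> R by rewrite expf_eq0 pnatr_eq0 andbF.
by rewrite intrM exprD; field; rewrite !n0.
Qed.

Lemma dyadic_nat (n : nat) : dy n%:R.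
Proof. by apply/dyadicE; exists n%:Z, 0%N; rewrite expr0 divr1. Qed.

Lemma dyadicVX (n : nat) : dy (2 ^+ n)^-1.
Proof. by apply/dyadicE; exists 1, n; rewrite mul1r. Qed.

(** The elements of [F] in the coordinate [0 <= x <= 1].  The last clause says at
    once that [phi] is onto and that it maps the dyadic points onto
    themselves. *)
Definition unit_pl phi : Prop :=
  [/\ phi 0 = 0, phi 1 = 1, (forall x y, 0 <= x -> x < y -> y <= 1 -> phi x < phi y),
      (exists s : seq R, (forall x, x \in s -> dy x) /\
        forall a b, 0 <= a -> a < b -> b <= 1 ->
          (forall x, a < x < b -> x \notin s) ->
          exists (k : int) (c : R), forall x, a <= x <= b -> phi x = 2 ^ k * x + c) &
      forall y, 0 <= y <= 1 -> exists x, [/\ 0 <= x <= 1, phi x = y & dy x <-> dy y]].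

Lemma unit_pl_le phi x y : unit_pl phi -> 0 <= x -> x <= y -> y <= 1 -> phi x <= phi y.
Proof.
move=> [_ _ mono _ _] x0; rewrite le_eqVlt => /orP[/eqP -> //|xy] y1.
exact/ltW/mono.
Qed.

Lemma unit_pl_itv phi x : unit_pl phi -> 0 <= x <= 1 -> 0 <= phi x <= 1.
Proof.
move=> up /andP[x0 x1]; have [phi0 phi1 _ _ _] := up.
by apply/andP; split; [rewrite -phi0|rewrite -phi1]; exact: unit_pl_le.
Qed.

Lemma unit_pl_itvo phi x : unit_pl phi -> 0 <= x < 1 -> 0 <= phi x < 1.
Proof.
move=> up /andP[x0 x1]; have [phi0 phi1 mono _ _] := up.
apply/andP; split; last by rewrite -phi1 mono.
by rewrite -phi0 unit_pl_le// ltW.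
Qed.

Lemma increasing_surj_continuous (G : R -> R) :
  {homo G : x y / x < y} -> (forall y, exists x, G x = y) -> continuous G.
Proof.
move=> Glt Gsurj x; apply/cvgrPdist_lt => e e0.
have [a aE] := Gsurj (G x - e); have [b bE] := Gsurj (G x + e).
have Gle u v : u <= v -> G u <= G v.
  by rewrite le_eqVlt => /orP[/eqP -> //|/Glt /ltW].
have ax : a < x by rewrite ltNge; apply/negP => /Gle; rewrite aE; lra.
have xb : x < b by rewrite ltNge; apply/negP => /Gle; rewrite bE; lra.
near=> y.
have ay : a < y by near: y; exact: lt_nbhsr.
have yb : y < b by near: y; exact: lt_nbhsl.
have := Glt _ _ ay; have := Glt _ _ yb; rewrite aE bE => ? ?.
by rewrite ltr_norml; apply/andP; split; lra.
Unshelve. all: by end_near. Qed.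

Section Realize.
Variable phi : R -> R.
Hypothesis up : unit_pl phi.

Definition periodic_lift x : R := phi (x - (Num.floor x)%:~R) + (Num.floor x)%:~R.
Let G := periodic_lift.

Let GE t (m : int) : 0 <= t <= 1 -> G (t + m%:~R) = phi t + m%:~R.
Proof.
have [phi0 phi1 _ _ _] := up.
move=> /andP[t0]; rewrite le_eqVlt => /orP[/eqP ->|t1].
  have fl : Num.floor (1 + m%:~R : R) = m + 1.
    by apply: floor_def; rewrite !intrD; apply/andP; split; lra.
  have -> : 1 + m%:~R = (m + 1)%:~R :> R by rewrite intrD addrC.
  rewrite /G /periodic_lift -[X in Num.floor X](_ : 1 + m%:~R = _) ?fl.
    by rewrite subrr phi0 phi1 add0r intrD addrC.
  by rewrite intrD addrC.
have fl : Num.floor (t + m%:~R) = m.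
  by apply: floor_def; rewrite !intrD; apply/andP; split; lra.
by rewrite /G /periodic_lift fl addrK.
Qed.

Let Glt : {homo G : x y / x < y}.
Proof.
have [phi0 phi1 mono _ _] := up.
move=> x y; have [m [t [t01 ->]]] := unit_decomposition x.
have [n [u [u01 ->]]] := unit_decomposition y.
have /andP[pt0 pt1] := unit_pl_itvo up t01; have /andP[pu0 pu1] := unit_pl_itvo up u01.
case/andP: t01 u01 => t0 t1 /andP[u0 u1] xy.
rewrite !GE ?t0 ?u0 ?ltW//.
case: (ltgtP m n) => mn.
- have : m%:~R + 1 <= n%:~R :> R by rewrite -[1]/(1%:~R) -intrD ler_int lezD1.
  by lra.
- have : n%:~R + 1 <= m%:~R :> R by rewrite -[1]/(1%:~R) -intrD ler_int lezD1.
  by lra.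
- by rewrite mn ltrD2r mono// ?ltW//; move: xy; rewrite mn ltrD2r.
Qed.

Let Gsurj y : exists x, G x = y /\ (dy x <-> dy y).
Proof.
have [phi0 phi1 mono _ surj] := up.
have [m [t [/andP[t0 t1] ->]]] := unit_decomposition y.
have [|x [x01 xt xd]] := surj t; first by rewrite t0 ltW.
by exists (x + m%:~R); rewrite GE// xt !circle_pt_int.
Qed.

Let G1 x (m : int) : G (x + m%:~R) = G x + m%:~R.
Proof.
have [n [t [/andP[t0 t1] ->]]] := unit_decomposition x.
by rewrite -addrA -intrD !GE ?t0 ?ltW// intrD addrA.
Qed.

Let circle_map (H : R -> R) (p : circle R) : circle R := pt (H (repr p)).

Let circle_mapE (H : R -> R) x : (forall x (m : int), H (x + m%:~R) = H x + m%:~R) ->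
  circle_map H (pt x) = pt (H x).
Proof.
move=> H1; rewrite /circle_map.
have /circle_ptP[m ->] : pt (repr (pt x)) = pt x by rewrite /circle_pt reprK.
by rewrite H1 circle_pt_int.
Qed.

Let circle_map_continuous (H : R -> R) : (forall x (m : int), H (x + m%:~R) = H x + m%:~R) ->
  continuous H -> continuous (circle_map H).
Proof.
move=> H1 cH; apply/quotient_continuous.
rewrite (_ : _ \o _ = pt \o H); last by apply/funext => y; exact: (circle_mapE y H1).
by move=> x; apply: continuous_comp; [exact: cH|exact: pi_continuous].
Qed.

(** The points over [0] are added to the breakpoints: then an interval without
    breakpoints inside lies between two consecutive integers, where
    [periodic_lift] is a translate of [phi]. *)
Lemma unit_pl_thompsonT : in_thompsonT (circle_map G).
Proof.
have [phi0 phi1 mono [s [sD spl]] surj] := up.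
have /choice[K KP] := Gsurj.
have GK : cancel K G by move=> y; have [] := KP y.
have Ginj : injective G.
  by move=> x y; case: (ltgtP x y) => // /Glt + E; rewrite E ltxx.
have KG : cancel G K by move=> x; apply: Ginj; rewrite GK.
have K1 x (m : int) : K (x + m%:~R) = K x + m%:~R by apply: Ginj; rewrite G1 !GK.
have Klt : {homo K : x y / x < y}.
  move=> x y xy; rewrite ltNge le_eqVlt; apply/negP => /orP[/eqP E|/Glt].
    by move: xy; rewrite -(GK x) -(GK y) E ltxx.
  by rewrite !GK => /lt_trans/(_ xy); rewrite ltxx.
have cG : continuous G.
  by apply: increasing_surj_continuous => // y; exists (K y).
have cK : continuous K.
  by apply: increasing_surj_continuous => // y; exists (G y).
have gE x := circle_mapE x G1; have kE x := circle_mapE x K1.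
split.
- exists (circle_map K); split; try exact: circle_map_continuous.
    by move=> p; have [x <-] := circle_pt_surj p; rewrite gE kE KG.
  by move=> p; have [x <-] := circle_pt_surj p; rewrite kE gE GK.
- apply/seteqP; split=> p.
    move=> [q + <-]; have [x <-] := circle_pt_surj q; rewrite gE => xD.
    by have [_ [h _]] := KP (G x); apply: h; rewrite KG.
  have [y <-] := circle_pt_surj p => yD; exists (pt (K y)); last by rewrite gE GK.
  by have [_ [_ h]] := KP y; exact: h.
exists G; split.
  by split=> // x; exact: (G1 x 1).
exists (pt 0 :: map pt s); split.
  move=> p; rewrite inE => /orP[/eqP ->|/mapP[x xs ->]]; last exact: sD.
  exact: (dyadic_nat 0).
move=> a b ab abs; have [m [t [/andP[t0 t1] aE]]] := unit_decomposition a.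
have bm : b <= 1 + m%:~R.
  rewrite leNgt; apply/negP => mb.
  have : pt (1 + m%:~R) \notin pt 0 :: map pt s by apply: abs; lra.
  by rewrite circle_pt_int (_ : pt 1 = pt 0) ?mem_head//; apply/circle_ptP; exists 1; rewrite add0r.
have [||||k [c kc]] := spl t (b - m%:~R); [by []|lra|lra| |].
  move=> x /andP[tx xb]; apply/negP => xs.
  have : pt (x + m%:~R) \notin pt 0 :: map pt s by apply: abs; apply/andP; split; lra.
  by rewrite circle_pt_int inE negb_or map_f ?andbF.
exists k, (c + m%:~R - 2 ^ k * m%:~R) => x /andP[ax xb].
have -> : x = (x - m%:~R) + m%:~R by rewrite subrK.
rewrite GE; last by apply/andP; split; lra.
rewrite kc; last by apply/andP; split; lra.
by ring.
Qed.

Lemma unit_pl_realize : exists g : F, forall t, 0 <= t <= 1 -> val (val g) (pt t) = pt (phi t).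
Proof.
have gE t : 0 <= t <= 1 -> circle_map G (pt t) = pt (phi t).
  by move=> t01; rewrite circle_mapE//; have := GE 0 t01; rewrite !addr0 => ->.
pose g : T := Sub (circle_map G) (asboolT unit_pl_thompsonT).
have gF : fixes0 g.
  by rewrite /fixes0 /= gE ?lexx ?ler01//; have [-> _ _ _ _] := up.
by exists (Sub g gF : F).
Qed.

End Realize.

End UnitInterval.

(** * Copies of F supported on small arcs *)

Section Insertion.
Variable R : realType.
Local Notation T := (thompsonT R).
Local Notation F := (thompsonF R).
Local Notation pt := (@circle_pt R).
Local Notation dy := (fun x : R => dyadic R (circle_pt x)).
Implicit Types (phi psi : R -> R) (x y t u : R).
Local Open Scope classical_set_scope.
Local Open Scope ring_scope.

Lemma thompsonT_dyadic (g : T) q : dyadic R (val g q) <-> dyadic R q.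
Proof.
have [_ gD _] := thompsonTP g.
split=> [|qD]; rewrite -{1}gD; last by exists q.
by move=> [r rD /(can_inj (thompsonTK g)) <-].
Qed.

(** Subtracting the integer [L 0] from a lift [L] of [f] makes it fix [0] and
    hence preserve the unit interval. *)
Lemma thompsonF_unit_pl (f : F) : exists2 phi, unit_pl phi &
  forall t, 0 <= t <= 1 -> val (val f) (pt t) = pt (phi t).
Proof.
have [[g [fK gK _ _]] _ [L [lL [s [sD sL]]]]] := thompsonTP (val f).
have [G [LG GL lG]] := oriented_lift_inv fK gK lL.
have [_ Llt L1 LE] := lL; have [_ Glt G1 GE] := lG.
have [n L0] : exists n : int, L 0 = n%:~R.
  have /circle_ptP[n nE] : pt (L 0) = pt 0 by rewrite LE; exact/eqP/(valP f).
  by exists n; rewrite nE add0r.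
have phiE t : pt (L t - n%:~R) = val (val f) (pt t).
  by rewrite -LE -[in RHS](subrK n%:~R (L t)) circle_pt_int.
have Gle x y : x <= y -> G x <= G y.
  by rewrite le_eqVlt => /orP[/eqP -> //|/Glt /ltW].
exists (fun t => L t - n%:~R); last by move=> t _; rewrite phiE.
split.
- by rewrite L0 subrr.
- by rewrite -[X in L X]add0r L1 L0 addrAC subrr add0r.
- by move=> x y _ xy _; rewrite ltrD2r Llt.
- have /choice[r rP] : forall q : circle R, exists t, 0 <= t < 1 /\ pt t = q.
    by move=> q; have [t t01 tq] := circle_pt_unit q; exists t.
  exists (map r s); split=> [_ /mapP[q qs ->]|a b a0 ab b1 abs].
    by have [_ ->] := rP q; exact: sD.
  have [||k [c kc]] := sL a b => //.
    move=> x /[dup] xab /andP[ax xb]; apply: contra (abs x xab) => xs.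
    apply/mapP; exists (pt x) => //; have [r01 rx] := rP (pt x).
    by apply: circle_pt_unit_inj => //; apply/andP; split; lra.
  by exists k, (c - n%:~R) => x xab; rewrite kc// addrA.
- move=> y /andP[y0 y1]; exists (G (y + n%:~R)); split.
  + have G0 : G n%:~R = 0 by rewrite -L0 LG.
    apply/andP; split; first by rewrite -G0 Gle// lerDr.
    have Gn1 : G (n%:~R + 1) = 1 by rewrite G1 G0 add0r.
    by rewrite -[leRHS]Gn1 Gle// addrC lerD2l.
  + by rewrite GL addrK.
  + by rewrite -(thompsonT_dyadic (val f)) -LE GL circle_pt_int.
Qed.

Lemma dyadic_affine c d x : c != 0 -> dy c -> dy c^-1 -> dy d ->
  dy (d + c * x) <-> dy x.
Proof.
move=> c0 cD cVD dD; split=> [h|xD]; last by apply: dyadicD => //; exact: dyadicM.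
have -> : x = c^-1 * (d + c * x - d) by field.
by apply: dyadicM => //; apply: dyadicD => //; exact: dyadicN.
Qed.

Section Insert.
Variables (p : R) (n : nat).
Let w : R := (2 ^+ n)^-1.
Hypotheses (pD : dy p) (p0 : 0 <= p) (pw1 : p + w <= 1).

Let w0 : 0 < w. Proof. by rewrite invr_gt0 exprn_gt0. Qed.

Let dyE x : dy (p + w * x) <-> dy x.
Proof.
apply: dyadic_affine => //; first by rewrite gt_eqF.
  exact: dyadicVX.
by rewrite invrK -natrX; exact: dyadic_nat.
Qed.

Definition insert phi x : R :=
  if p <= x <= p + w then p + w * phi ((x - p) / w) else x.

Let insertE phi t : 0 <= t <= 1 -> insert phi (p + w * t) = p + w * phi t.
Proof.
move=> /andP[t0 t1]; rewrite /insert.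
have -> : p <= p + w * t <= p + w.
  by rewrite lerDl lerD2l mulr_ge0 ?(ltW w0)//= ler_piMr// ltW.
by congr (_ + _ * phi _); field; rewrite gt_eqF.
Qed.

Let insert_out phi x : unit_pl phi -> x <= p \/ p + w <= x -> insert phi x = x.
Proof.
move=> [phi0 phi1 _ _ _] xpw; rewrite /insert; case: ifP => // /andP[px xp].
case: xpw => h.
  have -> : x = p by apply/eqP; rewrite eq_le h px.
  by rewrite subrr mul0r phi0 mulr0 addr0.
have -> : x = p + w by apply/eqP; rewrite eq_le h xp.
by rewrite addrAC subrr add0r divff ?gt_eqF// phi1 mulr1.
Qed.

Let rescale x : p <= x <= p + w -> exists2 t, 0 <= t <= 1 & x = p + w * t.
Proof.
move=> /andP[px xp]; exists ((x - p) / w); last by field; rewrite gt_eqF.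
by rewrite divr_ge0 ?ler_pdivrMr ?(ltW w0)//=; lra.
Qed.

(** The end points of the inserted interval become breakpoints, so that an
    interval without breakpoints inside is either outside of it or contained
    in it. *)
Lemma insert_unit_pl phi : unit_pl phi -> unit_pl (insert phi).
Proof.
move=> up; have [phi0 phi1 mono [s [sD spl]] surj] := up.
have in_range t : 0 <= t <= 1 -> p <= p + w * phi t <= p + w.
  move=> /(unit_pl_itv up)/andP[? ?].
  by rewrite lerDl lerD2l mulr_ge0 ?(ltW w0)//= ler_piMr// ltW.
split.
- by rewrite insert_out//; left.
- by rewrite insert_out//; right.
- move=> x y x0 xy y1.
  have [xin|/negP xout] := boolP (p <= x <= p + w); last first.
    have xE : insert phi x = x.
      apply: insert_out => //; case: (leP x p) => [|px]; [by left|right].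
      by rewrite leNgt; apply/negP => h; apply: xout; rewrite !ltW.
    rewrite xE; have [/[dup] yin /andP[py yp]|/negP yout] := boolP (p <= y <= p + w).
      have [u u01 yE] := rescale yin; rewrite yE insertE//.
      have /andP[h _] := in_range u u01; apply: lt_le_trans h.
      by rewrite ltNge; apply/negP => h; apply: xout; rewrite h; lra.
    rewrite insert_out//; case: (leP y p) => [|py]; [by left|right].
    by rewrite leNgt; apply/negP => h; apply: yout; rewrite !ltW.
  have [t t01 xE] := rescale xin; rewrite xE insertE//.
  have [yin|/negP yout] := boolP (p <= y <= p + w).
    have [u u01 yE] := rescale yin; rewrite yE insertE//.
    rewrite ltrD2l ltr_pM2l//; move: xy; rewrite xE yE ltrD2l ltr_pM2l// => tu.
    by case/andP: t01 u01 => t0 _ /andP[_ u1]; exact: mono.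
  have py : p + w < y.
    rewrite ltNge; apply/negP => h; apply: yout; rewrite h andbT.
    by case/andP: xin => ? _; lra.
  rewrite [ltRHS]insert_out//; last by right; exact: ltW.
  by have /andP[_ ?] := in_range t t01; lra.
- exists [:: p, p + w & [seq p + w * x | x <- s]]; split.
    move=> x; rewrite !inE => /or3P[/eqP ->//|/eqP ->|/mapP[y ys ->]].
      by apply: dyadicD => //; exact: dyadicVX.
    by apply/dyE; exact: sD.
  move=> a b a0 ab b1 abs.
  have [bp|pb] := leP b p.
    exists 0, 0 => x /andP[ax xb]; rewrite insert_out//; last by left; lra.
    by rewrite expr0z mul1r addr0.
  have [pa|ap] := leP (p + w) a.
    exists 0, 0 => x /andP[ax xb]; rewrite insert_out//; last by right; lra.
    by rewrite expr0z mul1r addr0.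
  have pa : p <= a.
    rewrite leNgt; apply/negP => h.
    by have := abs p; rewrite h pb !inE eqxx => /(_ isT).
  have bp : b <= p + w.
    rewrite leNgt; apply/negP => h.
    by have := abs (p + w); rewrite ap h !inE eqxx orbT => /(_ isT).
  have [|ta /andP[ta0 ta1] aE] := @rescale a; first by apply/andP; split; lra.
  have [|tb /andP[tb0 tb1] bE] := @rescale b; first by apply/andP; split; lra.
  have tab : ta < tb by move: ab; rewrite aE bE ltrD2l ltr_pM2l.
  have [|k [c kc]] := spl ta tb ta0 tab tb1.
    move=> x /andP[tax xtb]; apply/negP => xs.
    have := abs (p + w * x); rewrite aE bE !ltrD2l !ltr_pM2l// tax xtb => /(_ isT).
    suff -> : p + w * x \in [:: p, p + w & [seq p + w * x | x <- s]] by [].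
    by rewrite !inE; apply/or3P/Or33/mapP; exists x.
  exists k, (p - 2 ^ k * p + w * c) => x /andP[ax xb].
  have [|t t01 xE] := @rescale x; first by apply/andP; split; lra.
  rewrite xE insertE// kc; first by ring.
  by move: ax xb; rewrite aE bE xE !lerD2l !ler_pM2l// => -> ->.
- move=> y y01; have [yin|/negP yout] := boolP (p <= y <= p + w).
    have [u u01 yE] := rescale yin; have [x [x01 xu xd]] := surj u u01.
    exists (p + w * x); rewrite insertE// xu yE; split=> //; last by rewrite !dyE.
    case/andP: x01 => x0 x1; rewrite addr_ge0 ?mulr_ge0 ?(ltW w0)//=.
    by rewrite (le_trans _ pw1)// lerD2l ler_piMr// ltW.
  exists y; split=> //; rewrite insert_out//.
  case: (leP y p) => [|py]; [by left|right].
  by rewrite leNgt; apply/negP => h; apply: yout; rewrite !ltW.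
Qed.

Definition circle_arc (a b : R) : set (circle R) := [set pt y | y in [set y | a <= y < b]].

Lemma circle_arcE a b y : 0 <= a -> b <= 1 -> 0 <= y < 1 -> circle_arc a b (pt y) <-> a <= y < b.
Proof.
move=> a0 b1 y01; split=> [[x /= /andP[ax xb] xy]|yab]; last by exists y.
rewrite -(circle_pt_unit_inj _ y01 xy); first by rewrite ax.
by apply/andP; split; lra.
Qed.

(** [kappa f] moves the points of the arc as [f] moves their coordinate [t] and
    fixes all others.  This determines it, so that multiplicativity and
    injectivity can be checked on coordinates. *)
Lemma insertion : exists kappa : F -> T, [/\
  forall f g, kappa (f * g)%g = (kappa f * kappa g)%g,
  injective kappa,
  forall f q, ~ circle_arc p (p + w) q -> val (kappa f) q = q &
  forall (f : F) t u, 0 <= t < 1 -> 0 <= u < 1 -> val (val f) (pt t) = pt u ->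
    val (kappa f) (pt (p + w * t)) = pt (p + w * u)].
Proof.
have unitS t : 0 <= t < 1 -> 0 <= t <= 1 by move=> /andP[-> /ltW].
have range t : 0 <= t < 1 -> 0 <= p + w * t < 1.
  move=> /andP[t0 t1]; rewrite addr_ge0 ?mulr_ge0 ?(ltW w0)//=.
  by rewrite (lt_le_trans _ pw1)// ltrD2l gtr_pMr.
have /choice[kappa kP] : forall f : F, exists g : T,
    (forall q, ~ circle_arc p (p + w) q -> val g q = q) /\
    (forall t u, 0 <= t < 1 -> 0 <= u < 1 -> val (val f) (pt t) = pt u ->
      val g (pt (p + w * t)) = pt (p + w * u)).
  move=> f; have [phi up phiE] := thompsonF_unit_pl f.
  have [g gE] := unit_pl_realize (insert_unit_pl up).
  exists (val g); split=> [q|t u t01 u01 tu].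
    have [y y01 <-] := circle_pt_unit q => yout.
    rewrite gE ?unitS// insert_out//; have [|py] := leP y p; first by left.
    right; rewrite leNgt; apply/negP => h; apply: yout.
    by exists y => //=; rewrite h ltW.
  rewrite gE ?unitS ?range// insertE ?unitS//; congr (pt (_ + _ * _)).
  apply: circle_pt_unit_inj => //; first exact: unit_pl_itvo.
  by rewrite -phiE// unitS.
have kout f : forall q, ~ circle_arc p (p + w) q -> val (kappa f) q = q by have [] := kP f.
have kin f := (kP f).2.
have image (f : F) t : exists2 u, 0 <= u < 1 & val (val f) (pt t) = pt u.
  by have [u u01 uE] := circle_pt_unit (val (val f) (pt t)); exists u.
have circle_arc_pt q : circle_arc p (p + w) q -> exists2 t, 0 <= t < 1 & q = pt (p + w * t).
  move=> [y /= /andP[py yp] <-]; exists ((y - p) / w).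
    by rewrite divr_ge0 ?ltr_pdivrMr ?(ltW w0)//=; lra.
  by congr pt; field; rewrite gt_eqF.
exists kappa; split=> //.
- move=> f g; apply: thompsonT_eq => q.
  rewrite -[RHS]/(val (kappa f) (val (kappa g) q)).
  have [/circle_arc_pt[t t01 ->]|nq] := pselect (circle_arc p (p + w) q); last by rewrite !kout.
  have [u u01 tu] := image g t; have [v v01 uv] := image f u.
  rewrite (kin g _ _ t01 u01 tu) (kin f _ _ u01 v01 uv) (kin _ _ _ t01 v01)//.
  by rewrite -uv -tu.
- move=> f g fg; apply: val_inj; apply: thompsonT_eq => q.
  have [t t01 <-] := circle_pt_unit q.
  have [u u01 tu] := image f t; have [v v01 tv] := image g t.
  rewrite tu tv; congr pt.
  have := kin g _ _ t01 v01 tv; rewrite -fg (kin f _ _ t01 u01 tu).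
  move/(circle_pt_unit_inj (range _ u01) (range _ v01))/addrI.
  by apply: mulfI; rewrite gt_eqF.
Qed.

End Insert.

(** The standard generator of [F] with breakpoints 1/2 and 3/4; it shifts
    [1/2 <= x < 3/4] to [1/4 <= x < 1/2]. *)
Definition x0_map x : R :=
  if x <= 2^-1 then x / 2 else if x <= 3 / 4 then x - 4^-1 else 2 * x - 1.

Lemma x0_unit_pl : unit_pl x0_map.
Proof.
have dy2 : dy 2 := @dyadic_nat R 2.
have dyV2 : dy 2^-1 := @dyadicVX R 1.
have dyV4 : dy 4^-1 by rewrite (_ : 4 = 2 ^+ 2); [exact: dyadicVX|rewrite -natrX].
rewrite /x0_map; split.
- by rewrite ifT ?mul0r//; lra.
- by rewrite !ifF; lra.
- move=> x y x0 xy y1.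
  by have [?|?] := leP x 2^-1; have [?|?] := leP x (3 / 4);
     have [?|?] := leP y 2^-1; have [?|?] := leP y (3 / 4); lra.
- exists [:: 2^-1; 3 / 4]; split.
    move=> x; rewrite !inE => /orP[/eqP ->//|/eqP ->].
    by apply: dyadicM => //; exact: (@dyadic_nat R 3).
  move=> a b a0 ab b1 abs.
  have [b2|b2] := leP b 2^-1.
    exists (-1), 0 => x /andP[ax xb]; rewrite ifT; last by lra.
    by rewrite exprN1; lra.
  have a2 : 2^-1 <= a.
    rewrite leNgt; apply/negP => h.
    by have := abs 2^-1; rewrite h b2 !inE eqxx => /(_ isT).
  have [b3|b3] := leP b (3 / 4).
    exists 0, (- 4^-1) => x /andP[ax xb]; rewrite expr0z mul1r.
    by have [?|?] := leP x 2^-1; [lra|rewrite ifT; lra].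
  have a3 : 3 / 4 <= a.
    rewrite leNgt; apply/negP => h.
    by have := abs (3 / 4); rewrite h b3 !inE eqxx orbT => /(_ isT).
  exists 1, (- 1) => x /andP[ax xb]; rewrite expr1z.
  by have [?|?] := leP x 2^-1; have [?|?] := leP x (3 / 4); lra.
- move=> y /andP[y0 y1].
  have [y4|y4] := leP y 4^-1.
    exists (2 * y); rewrite ifT; last by lra.
    split; [by lra|by lra|].
    by rewrite -[2 * y]add0r dyadic_affine//; exact: (@dyadic_nat R 0).
  have [y2|y2] := leP y 2^-1.
    exists (4^-1 + 1 * y); split; [by lra| |].
      by rewrite mul1r ifF ?ifT; lra.
    by apply: dyadic_affine; rewrite ?oner_eq0 ?invr1//; exact: (@dyadic_nat R 1).
  exists (2^-1 + 2^-1 * y); split; [by lra| |].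
    by rewrite !ifF; lra.
  by apply: dyadic_affine; rewrite ?invr_eq0 ?invrK.
Qed.

End Insertion.

(** * The two implications *)

Section Main.
Variable R : realType.
Local Notation T := (thompsonT R).
Local Notation F := (thompsonF R).
Local Notation pt := (@circle_pt R).
Local Notation lam := (@lambda_rep R).
Local Notation pir := (@pi_rep R).
Local Open Scope classical_set_scope.
Local Open Scope ring_scope.

Definition disjoint_supports (g h : T) : Prop := forall q, val g q = q \/ val h q = q.

Lemma disjoint_supportsC g h : disjoint_supports g h -> (g * h = h * g)%g.
Proof.
move=> gh; apply: thompsonT_eq => q.
change (val g (val h q) = val h (val g q)).
case: (gh q) => [gq|hq].
  rewrite gq; case: (gh (val h q)) => [//|/(can_inj (thompsonTK h)) hq].
  by rewrite hq gq.
rewrite hq; case: (gh (val g q)) => [/(can_inj (thompsonTK g)) gq|//].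
by rewrite gq hq.
Qed.

Lemma disjoint_arcs (g h : T) a b c d : 0 <= a -> b <= c -> d <= 1 ->
  (forall q, ~ circle_arc a b q -> val g q = q) -> (forall q, ~ circle_arc c d q -> val h q = q) ->
  disjoint_supports g h.
Proof.
move=> a0 bc d1 gS hS q; have [y /[dup] y01 /andP[y0 y1] <-] := circle_pt_unit q.
have [cd|ncd] := pselect (circle_arc c d (pt y)); last by right; exact: hS.
left; apply: gS; case=> x /= /andP[ax xb] xy; case: cd => z /= /andP[cz zd] zy.
have : x = z.
  by apply: circle_pt_unit_inj; rewrite ?xy ?zy//; apply/andP; split; lra.
lra.
Qed.

(** A dyadic point is fixed by [g] or by [h], and these commute; so the two
    sides send its basis vector to the same pair of basis vectors. *)
Lemma pi_rep_disjoint_supports g h : disjoint_supports g h ->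
  pir 1%g + pir (g * h)%g = pir g + pir h.
Proof.
move=> gh; apply: bop_eq => u; apply: l2_eq => x; rewrite !bop_addE !l2_addE pi_rep1.
have fixV (k : T) : val k (val x) = val x -> dyadic_act k^-1%g x = x.
  by move=> kx; apply: val_inj; rewrite /= -{1}kx thompsonTK.
have [/fixV gx|/fixV hx] := gh (val x).
  rewrite pi_repM.
  change (val u x + val u (dyadic_act h^-1%g (dyadic_act g^-1%g x)) =
          val u (dyadic_act g^-1%g x) + val u (dyadic_act h^-1%g x)).
  by rewrite gx.
rewrite disjoint_supportsC// pi_repM addrC.
change (val u (dyadic_act g^-1%g (dyadic_act h^-1%g x)) + val u x =
        val u (dyadic_act g^-1%g x) + val u (dyadic_act h^-1%g x)).
by rewrite hx.
Qed.

(** Insert [x0_map] in the half-circle that starts at [p].  It shifts the arc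
    from [p + 1/4] to [p + 3/8] by -1/8, thus off itself; this arc carries the
    copy of [F]. *)
Lemma displacing_element (p : R) : dyadic R (pt p) -> 0 <= p -> p + 2^-1 <= 1 ->
  exists (a : T) (iota : F -> T), [/\
    forall q, ~ circle_arc p (p + 2^-1) q -> val a q = q,
    (forall f g, iota (f * g)%g = (iota f * iota g)%g) /\ injective iota,
    forall f q, ~ circle_arc (p + 4^-1) (p + 4^-1 + 8^-1) q -> val (iota f) q = q &
    forall q, circle_arc (p + 4^-1) (p + 4^-1 + 8^-1) q ->
      ~ circle_arc (p + 4^-1) (p + 4^-1 + 8^-1) (val a q)].
Proof.
move=> pD p0 p1.
have e2 : (2 ^+ 1)^-1 = 2^-1 :> R by [].
have e8 : (2 ^+ 3)^-1 = 8^-1 :> R by rewrite -natrX.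
have [k1] := @insertion R p 1 pD p0 p1; rewrite e2 => -[_ _ k1S k1E].
have [|||iota] := @insertion R (p + 4^-1) 3.
- by apply: dyadicD => //; rewrite (_ : 4 = 2 ^+ 2); [exact: dyadicVX|rewrite -natrX].
- lra.
- by rewrite e8; lra.
rewrite e8 => -[iotaM iota_inj iotaS _].
have [x0 x0E] := unit_pl_realize (x0_unit_pl R).
exists (k1 x0), iota; split=> //; first exact: k1S.
move=> _ [y /= /andP[y1 y2] <-].
have E : val (k1 x0) (pt (p + 2^-1 * (2 * (y - p)))) =
    pt (p + 2^-1 * (2 * (y - p) - 4^-1)).
  apply: k1E; [lra|lra|rewrite x0E; last lra].
  by rewrite /x0_map; have [?|?] := leP _ 2^-1; [congr pt; lra|rewrite ifT//; lra].
have -> : y = p + 2^-1 * (2 * (y - p)) by lra.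
have yE : p + 2^-1 * (2 * (y - p) - 4^-1) = y - 8^-1 by lra.
have y01 : 0 <= y - 8^-1 < 1 by lra.
have [u0 v1] : 0 <= p + 4^-1 /\ p + 4^-1 + 8^-1 <= 1 by lra.
by rewrite E yE => /(circle_arcE u0 v1 y01); lra.
Qed.

Lemma displacing_neq1 (a : T) (I : set (circle R)) :
  I !=set0 -> (forall q, I q -> ~ I (val a q)) -> a <> 1%g.
Proof. by move=> [q Iq] aI a1; apply: (aI q Iq); rewrite a1. Qed.

(** With [a] and [b] displacing arcs in opposite half-circles, the difference of
    the sums over [1; a * b] and over [a; b] is [(1 - lam a) * (1 - lam b)].
    Propagation along [a] puts [1 - lam b] in the ideal, as the copy of [F]
    displaced by [a] commutes with [b]; propagation along [b] then puts [1]
    in it. *)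
Lemma nonamenable_full_ideal : ~ amenable R F ->
  exists H1 H2 : {fset T},
    [/\ [disjoint H1 & H2]%fset,
        \sum_(g <- H1) pir g = \sum_(h <- H2) pir h &
        closed_ideal_gen (Cstar_red R)
          (\sum_(g <- H1) lam g - \sum_(h <- H2) lam h) = Cstar_red R].
Proof.
move=> nam.
have [|||a [ia [aS [iaM iaI] iaS aD]]] := @displacing_element 0; [exact: (@dyadic_nat R 0)|by []|lra|].
have [|||b [ib [bS [ibM ibI] ibS bD]]] := @displacing_element 2^-1; [exact: (@dyadicVX R 1)|lra|lra|].
have ab : disjoint_supports a b by apply: disjoint_arcs aS bS; lra.
have iab f : disjoint_supports (ia f) b by apply: disjoint_arcs (iaS f) bS; lra.
have ne (u v : R) : 0 <= u -> u < v -> v <= 1 -> circle_arc u v !=set0.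
  by move=> u0 uv v1; exists (pt u), u => //=; rewrite lexx.
have a1 : a <> 1%g by apply: displacing_neq1 aD; apply: ne; lra.
have b1 : b <> 1%g by apply: displacing_neq1 bD; apply: ne; lra.
have aNb : a <> b.
  move=> E; apply: a1; apply: thompsonT_eq => q.
  by case: (ab q) => //; rewrite E.
have ab1 : (a * b)%g <> 1%g.
  move=> E; apply: a1; apply: thompsonT_eq => q; case: (ab q) => // bq.
  by rewrite -[in LHS]bq; have := congr1 (fun k : T => val k q) E.
pose H1 : {fset T} := [fset 1%g; (a * b)%g]%fset; pose H2 : {fset T} := [fset a; b]%fset.
have sum2 (V : zmodType) (r : T -> V) x y : x != y ->
    \sum_(g <- [fset x; y]%fset) r g = r x + r y.
  by move=> xy; rewrite big_fsetU1 ?inE// big_seq_fset1.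
have ab1' : 1%g != (a * b)%g by apply/eqP => E; apply: ab1; rewrite -E.
have aNb' : a != b by exact/eqP.
have prodE : \sum_(g <- H1) lam g - \sum_(h <- H2) lam h = (1 - lam a) * (1 - lam b).
  rewrite /H1 /H2 !sum2// lambda_rep1 lambda_repM mulrBl mul1r mulrBr mulr1.
  by rewrite opprB opprD -!addrA; congr (1 + _); rewrite [RHS]addrC -addrA.
exists H1, H2; split.
- rewrite fdisjoint_sym /H1 /H2; apply/fdisjointP => x; rewrite !inE.
  move=> /orP[/eqP ->|/eqP ->]; rewrite negb_or; apply/andP; split; apply/eqP => //.
    by move=> E; apply: b1; apply: (@mulgI _ a); rewrite mulg1 -E.
  by move=> E; apply: a1; apply: (@mulIg _ b); rewrite mul1g -E.
- by rewrite /H1 /H2 !sum2//; exact: pi_rep_disjoint_supports.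
rewrite prodE; apply/seteqP; split=> x.
  apply; split; first exact: Cstar_red_ideal.
  rewrite -prodE; have [_ _ _ CD [CZ _ _]] := Cstar_red_ideal R.
  apply: CD; last rewrite -scaleN1r; last apply: CZ; rewrite -rep_sum_set; exact: Cstar_red_rep_sum.
move=> Cx J [Jid J0].
have Jb : J (1 - lam b).
  apply: (ideal_propagation iaM iaI iaS aD nam Jid) J0 => f.
  rewrite mulrBl mulrBr mul1r mulr1 -!lambda_repM.
  by rewrite (disjoint_supportsC (iab f)).
have J1 : J 1.
  apply: (ideal_propagation ibM ibI ibS bD nam Jid) => [f|]; last by rewrite mulr1.
  by rewrite mul1r mulr1.
by have [_ _ _ _ [_ JA _]] := Jid; rewrite -(mulr1 x); apply: JA.
Qed.

(** The closure of the kernel of pi is a closed ideal that contains the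
    generator and not [1]. *)
Lemma amenable_proper_ideal (H1 H2 : {fset T}) : amenable R F ->
  \sum_(g <- H1) pir g = \sum_(h <- H2) pir h ->
  closed_ideal_gen (Cstar_red R)
    (\sum_(g <- H1) lam g - \sum_(h <- H2) lam h) <> Cstar_red R.
Proof.
move=> /amenable_folner fol HE E; apply: (pi_kernel_proper fol).
have : Cstar_red R 1 by rewrite -lambda_rep1; exact: Cstar_red_lambda.
rewrite -E; apply; split; first exact: pi_kernel_ideal.
apply: subset_closure.
pose s := [seq (1 : R[i], g) | g <- H1] ++ formal_scale (-1) [seq (1 : R[i], h) | h <- H2].
exists s; rewrite rep_sum_cat rep_sum_scale !rep_sum_set scaleN1r//.
by rewrite HE subrr.
Qed.

End Main.

Local Open Scope ring_scope.

Theorem theorem1 (R : realType) :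
  ~ amenable R (thompsonF R) <->
  exists H H1 H2 : {fset thompsonT R},
    [/\ H = (H1 `|` H2)%fset,
        [disjoint H1 & H2]%fset,
        \sum_(g <- H1) pi_rep g = \sum_(h <- H2) pi_rep h &
        closed_ideal_gen (Cstar_red R)
          (\sum_(g <- H1) lambda_rep g - \sum_(h <- H2) lambda_rep h)
        = Cstar_red R].
Proof.
split=> [/nonamenable_full_ideal[H1 [H2 [dis HE full]]]|].
  by exists (H1 `|` H2)%fset, H1, H2.
by move=> [H [H1 [H2 [_ _ HE full]]]] am; exact: (amenable_proper_ideal am HE full).
Qed.
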